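(* Let $\{f(x|\theta,\sigma,m):(\theta,m)\in\Theta,\sigma^2\in\Omega\}$ be the class of skew-Gaussian densities, with $\Theta\subset\mathbb{R}^2$, $\Omega\subset\mathbb{R}_+$. Fix $G_0=\sum_{i=1}^{k_0}p_i^0\delta_{(\theta_i^0,(\sigma_i^0)^2,m_i^0)}\in\mathcal{E}_{k_0}(\Theta\times\Omega)$ such that the $\sigma_i^0$ are pairwise different and $\frac{(\sigma_i^0)^2}{1+(m_i^0)^2}\notin\{(\sigma_j^0)^2:1\le j\ne i\le k_0\}$ for all $1\le i\le k_0$, and assume that, for all $i=1,\dots,k_0$, $m_i^0\ne0$ and the cousin set $$I_i=\Big\{l\ne i:\Big(\frac{(\sigma_l^0)^2}{1+(m_l^0)^2},\theta_l^0\Big)=\Big(\frac{(\sigma_i^0)^2}{1+(m_i^0)^2},\theta_i^0\Big)\Big\}$$ is empty. Let $k\ge k_0+1$ and let $\overline r\ge1$ be the minimum integer $r\ge1$ such that the system $$\sum_{j=1}^{k-k_0+1}\ \sum_{\substack{n_1+2n_2=\alpha\\ n_1,n_2\ge0}}\frac{c_j^2a_j^{n_1}b_j^{n_2}}{n_1!\,n_2!}=0,\qquad\alpha=1,\dots,r,$$ has no non-trivial real solution $(c_j,a_j,b_j)_{j=1}^{k-k_0+1}$, where non-trivial means all $c_j\ne0$ and at least one $a_j\ne0$. For a fixed constant $c_0>0$ let $$\mathcal{O}_{k,c_0}(\Theta\times\Omega)=\Big\{G=\sum_{i=1}^{k^*}p_i\delta_{(\theta_i,\sigma_i^2,m_i)}\in\mathcal{O}_k(\Theta\times\Omega):p_i\ge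 c_0\ \forall\,1\le i\le k^*\le k\Big\}.$$ Let $\overline m=\overline r$ if $\overline r$ is even and $\overline m=\overline r+1$ if $\overline r$ is odd. Then there are $\epsilon_0,C_0>0$ such that for any $G\in\mathcal{O}_{k,c_0}(\Theta\times\Omega)$ with $W_{\overline m}(G,G_0)\le\epsilon_0$, $$V(p_G,p_{G_0})\ge C_0W_{\overline m}^{\overline m}(G,G_0).$$
   Context: Skew-Gaussian density: $f(x|\theta,\sigma,m)=\frac2\sigma\varphi\left(\frac{x-\theta}\sigma\right)\Phi\left(\frac{m(x-\theta)}\sigma\right)$, with $\varphi(x)=\frac1{\sqrt{2\pi}}e^{-x^2/2}$, $\Phi(x)=\int_{-\infty}^x\varphi(t)dt$; $\theta$ is location, $\sigma>0$ scale, $m\in\mathbb{R}$ shape. $\mathcal{E}_k(\Theta\times\Omega)$ (resp. $\mathcal{O}_k(\Theta\times\Omega)$): discrete probability measures with exactly (resp. at most) $k$ distinct atoms $(\theta,\sigma^2,m)$, where $(\theta,m)\in\Theta$, $\sigma^2\in\Omega$. For $G=\sum_ip_i\delta_{(\theta_i,\sigma_i^2,m_i)}$, $p_G=\sum_ip_if(\cdot|\theta_i,\sigma_i,m_i)$. $V(p,q)=\frac12\int|p-q|dx$. $W_r(G,G')=\big(\inf_q\sum_{i,j}q_{ij}(\|(\theta_i,m_i)-(\theta'_j,m'_j)\|+|\sigma_i^2-\sigma_j'^2|)^r\big)^{1/r}$, infimum over couplings $q$ of the weight vectors. *)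

(* Defs.v *)
From mathcomp Require Import all_boot all_order all_algebra.
From mathcomp Require Import all_classical all_reals all_analysis.
Set Implicit Arguments.
Unset Strict Implicit.
Unset Printing Implicit Defensive.
Import Order.TTheory GRing.Theory Num.Theory.
Local Open Scope classical_set_scope.
Local Open Scope ring_scope.

Definition std_pdf (R : realType) (x : R) : R := normal_pdf 0 1 x.

Lemma std_pdfE (R : realType) (x : R) :
  std_pdf x = (Num.sqrt (2 * pi))^-1 * expR (- (x ^+ 2 / 2)).
Proof.
rewrite /std_pdf normal_pdfE ?oner_neq0// /normal_peak /normal_fun.
by rewrite expr1n mul1r subr0 mulr_natl mulNr.
Qed.

Definition std_cdf (R : realType) (x : R) : R :=
  \int[lebesgue_measure]_(t in `]-oo, x]) std_pdf t.

Definition skew_pdf (R : realType) (theta sigma m x : R) : R :=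
  2 / sigma * std_pdf ((x - theta) / sigma) * std_cdf (m * (x - theta) / sigma).

(* A point (theta, sigma^2, m): the second coordinate is the variance. *)
Record skew_param (R : realType) := SkewParam {
  location : R;
  sqscale : R;
  slant : R }.

Definition scale (R : realType) (e : skew_param R) : R := Num.sqrt (sqscale e).

(* The discrete probability measure \sum_i (weight i) \d_(atom i), presented by
   its pairwise distinct atoms and their positive weights. *)
Record mixing (R : realType) := Mixing {
  natoms : nat;
  weight : 'I_natoms -> R;
  atom : 'I_natoms -> skew_param R;
  weight_gt0 : forall i, 0 < weight i;
  weight_sum1 : \sum_i weight i = 1;
  atom_inj : injective atom }.

Arguments weight {R} m i.
Arguments atom {R} m i.

Definition atoms_in (R : realType) (Theta : set (R * R)) (Omega : set R)
    (G : mixing R) : Prop :=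
  forall i, Theta (location (atom G i), slant (atom G i)) /\
            Omega (sqscale (atom G i)).

Definition mixE (R : realType) (k : nat) (Theta : set (R * R)) (Omega : set R) :
    set (mixing R) :=
  [set G | natoms G = k /\ atoms_in Theta Omega G].

Definition mixO (R : realType) (k : nat) (Theta : set (R * R)) (Omega : set R) :
    set (mixing R) :=
  [set G | (natoms G <= k)%N /\ atoms_in Theta Omega G].

Definition mixOc (R : realType) (k : nat) (c0 : R) (Theta : set (R * R))
    (Omega : set R) : set (mixing R) :=
  [set G | mixO k Theta Omega G /\ forall i, c0 <= weight G i].

Definition mix_pdf (R : realType) (G : mixing R) (x : R) : R :=
  \sum_i weight G i *
    skew_pdf (location (atom G i)) (scale (atom G i)) (slant (atom G i)) x.

Definition tv_dist (R : realType) (p q : R -> R) : R :=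
  2^-1 * \int[lebesgue_measure]_(x in setT) `|p x - q x|.

(* Euclidean norm on (theta, m); the library norm on R * R is the sup norm. *)
Definition param_dist (R : realType) (e e' : skew_param R) : R :=
  Num.sqrt ((location e - location e') ^+ 2 + (slant e - slant e') ^+ 2)
  + `|sqscale e - sqscale e'|.

Definition coupling (R : realType) (G G' : mixing R) :
    set 'M[R]_(natoms G, natoms G') :=
  [set q | [/\ forall i j, 0 <= q i j,
               forall i, \sum_j q i j = weight G i &
               forall j, \sum_i q i j = weight G' j]].

Arguments coupling {R} G G'.

Definition wasserstein (R : realType) (r : nat) (G G' : mixing R) : R :=
  inf [set \sum_i \sum_j q i j * param_dist (atom G i) (atom G' j) ^+ r
      | q in coupling G G'] `^ (r%:R^-1).

Definition cousin_key (R : realType) (e : skew_param R) : R * R :=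
  (sqscale e / (1 + slant e ^+ 2), location e).

Definition cousins (R : realType) (G : mixing R) (i : 'I_(natoms G)) :
    {set 'I_(natoms G)} :=
  [set l | (l != i) && (cousin_key (atom G l) == cousin_key (atom G i))]%SET.

Arguments cousins {R} G i.

(* The constraint n1 + 2 n2 = alpha forces n1, n2 <= alpha, so the bounds on n1
   and n2 lose no term. *)
Definition solves_system (R : realType) (N r : nat) (c a b : 'I_N -> R) : Prop :=
  forall alpha : nat, (1 <= alpha <= r)%N ->
    \sum_(j < N) \sum_(n1 < alpha.+1)
      \sum_(n2 < alpha.+1 | (n1 + 2 * n2 == alpha)%N)
        c j ^+ 2 * a j ^+ n1 * b j ^+ n2 / (n1`! * n2`!)%:R = 0.

Definition has_nontrivial_solution (R : realType) (N r : nat) : Prop :=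
  exists c a b : 'I_N -> R,
    [/\ forall j, c j != 0, exists j, a j != 0 & solves_system r c a b].

Definition is_rbar (R : realType) (N r : nat) : Prop :=
  [/\ (1 <= r)%N, ~ has_nontrivial_solution R N r &
      forall s, (1 <= s)%N -> ~ has_nontrivial_solution R N s -> (r <= s)%N].

Definition mbar (r : nat) : nat := if odd r then r.+1 else r.

(* Main.v *)
Require Import Defs.
From mathcomp Require Import all_boot all_order all_algebra.
From mathcomp Require Import all_classical all_reals all_analysis.
From mathcomp Require Import ring lra zify.
From mathcomp Require polyrcf.
Set Implicit Arguments.
Unset Strict Implicit.
Unset Printing Implicit Defensive.
Import Order.TTheory GRing.Theory Num.Theory.
Import numFieldNormedType.Exports.
Local Open Scope classical_set_scope.
Local Open Scope ring_scope.

(** With [l = m / sigma], half of the skew-Gaussian density is [N * Phi], where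
    [N] is the Gaussian density of mean [theta] and variance [sigma ^ 2] and [Phi]
    is the normal distribution function at [l * (x - theta)].  If the weights are
    at least [c0] and the distance to [G0] is small, then every atom of [G] is
    close to one atom of [G0].  Let [T] be the largest increment of a parameter,
    the variance being measured by its square root, and expand the density of
    every atom around that of its neighbour.  The terms that carry [Phi] have as
    coefficients the sums of the polynomial system, because the variance acts on
    [N] through the heat equation; the other terms are polynomials times Gaussian
    densities, and the coefficient of [(x - theta) ^ 3] is a negative multiple of
    [l * dl ^ 2], up to [T ^ 3].  By the hypotheses on [G0] all these functions are
    linearly independent, so each coefficient is read off by a finite combination
    of integrals over segments, which is bounded by the total variation distance.
    If [T] is attained by some [dl], the cubic coefficient gives [T ^ 2 = O(V)].
    Otherwise the unsolvability of the system and compactness give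
    [T ^ rbar = O(V)].  The constant coefficients then control the weights, and an
    explicit coupling bounds the Wasserstein distance. *)

(** * Derivatives of the Gaussian density *)

(** The delicate point is to keep the two kinds of terms from interfering. The functionals that read
    off the terms carrying [Phi] annihilate every polynomial of bounded degree times a product of
    two Gaussian densities; the increments [dl], which occur only in the latter, thus disappear from
    those equations, and expanding to high order costs nothing there. The [dl] come back from a
    second expansion, of order two only. A sum linear in the [dl] could cancel within a group of
    atoms, but the coefficient of degree three is a weighted sum of squares with one sign, so
    weights of at least [c0] bound each [dl] separately. Measuring the variance by a square root
    makes the system quasi-homogeneous: after division by [T] the unknowns lie in a compact set. All
    estimates have the form main term <= K * (distance + T * main term), so that the remainder is
    absorbed once [T] is small; no sequences and no passage to a limit in [G] are used. *)

Definition gauss (R : realType) (v z : R) : R :=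
  (Num.sqrt (2 * pi * v))^-1 * expR (- (z ^+ 2 / (2 * v))).

(** These are Hermite polynomials at scale [sqrt v]: with the probabilists' [He_n], [herm v n] at
    [z] is [v ^ (- n / 2) * He_n (z / sqrt v)]. *)
Fixpoint herm (R : realType) (v : R) (n : nat) : {poly R} :=
  match n with
  | 0 => 1
  | n1.+1 => match n1 with
             | 0 => v^-1 *: 'X
             | n2.+1 => v^-1 *: ('X * herm v n1 - n1%:R *: herm v n2)
             end
  end.

(* [gauss_jet n v] is the [n]-th derivative of the centred Gaussian density of
   variance [v], up to the sign [(-1) ^+ n]. *)
Definition gauss_jet (R : realType) (n : nat) (v z : R) : R :=
  (herm v n).[z] * gauss v z.

Lemma size_herm (R : realType) (v : R) (n : nat) : 0 < v -> size (herm v n) = n.+1.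
Proof.
move=> v0; have vn0 : v^-1 != 0 by rewrite invr_eq0 gt_eqF.
elim/ltn_ind: n => -[_|[_|n IH]]; first by rewrite size_poly1.
  by rewrite /= size_scale// size_polyX.
have sX : size ('X * herm v n.+1) = n.+3.
  by rewrite mulrC size_mulX ?IH// -size_poly_eq0 IH.
rewrite [herm _ _]/= -/(herm v n.+1) size_scale// size_polyDl ?sX//.
by rewrite size_polyN (leq_ltn_trans (size_scale_leq _ _))// IH.
Qed.

Lemma gauss_gt0 (R : realType) (v z : R) : 0 < v -> 0 < gauss v z.
Proof.
by move=> v0; rewrite mulr_gt0 ?expR_gt0// invr_gt0 sqrtr_gt0 !mulr_gt0 ?pi_gt0.
Qed.

Lemma gauss_le (R : realType) (u v z : R) :
  0 < u -> u <= v -> gauss v z <= (Num.sqrt (2 * pi * u))^-1.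
Proof.
move=> u0 uv; have v0 := lt_le_trans u0 uv; rewrite /gauss.
rewrite (@le_trans _ _ (Num.sqrt (2 * pi * v))^-1)//.
  rewrite ler_piMr ?invr_ge0 ?sqrtr_ge0// -[leRHS]expR0 ler_expR oppr_le0.
  by rewrite mulr_ge0 ?sqr_ge0// invr_ge0 mulr_ge0// ltW.
rewrite lef_pV2 ?posrE ?sqrtr_gt0 ?mulr_gt0 ?pi_gt0//.
by rewrite ler_sqrt ?mulr_ge0 ?pi_ge0 ?(ltW v0)// ler_pM2l// mulr_gt0 ?pi_gt0.
Qed.

Lemma gauss_jetSS (R : realType) n (v z : R) :
  gauss_jet n.+2 v z = v^-1 * (z * gauss_jet n.+1 v z - n.+1%:R * gauss_jet n v z).
Proof.
rewrite /gauss_jet.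
have -> : herm v n.+2 = v^-1 *: ('X * herm v n.+1 - n.+1%:R *: herm v n) by [].
by rewrite hornerZ hornerD hornerN hornerZ hornerM hornerX; ring.
Qed.

Lemma gauss_jet0 (R : realType) (v z : R) : gauss_jet 0 v z = gauss v z.
Proof. by rewrite /gauss_jet/= hornerC mul1r. Qed.

Lemma gauss_jet1 (R : realType) (v z : R) :
  gauss_jet 1 v z = v^-1 * (z * gauss v z).
Proof.
rewrite /gauss_jet (_ : herm v 1 = v^-1 *: 'X)//.
by rewrite hornerZ hornerX -mulrA.
Qed.

Lemma is_derive_gauss (R : realType) (v z : R) : 0 < v ->
  is_derive z 1 (gauss v) (- gauss_jet 1 v z).
Proof.
move=> v0; rewrite gauss_jet1 /gauss; apply: is_derive_eq.
rewrite scaler0 add0r /GRing.scale/= !mulr1; field.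
by rewrite !lt0r_neq0// sqrtr_gt0 !mulr_gt0 ?pi_gt0.
Qed.

(** This is the heat equation: the derivative in the variance is half the second derivative in
    space. *)
Lemma is_derive_gauss_var (R : realType) (v z : R) : 0 < v ->
  is_derive v 1 (fun v => gauss v z) (gauss_jet 2 v z / 2).
Proof.
move=> v0; rewrite gauss_jetSS gauss_jet1 gauss_jet0 /gauss.
have cv0 : 0 < 2 * pi * v by rewrite !mulr_gt0 ?pi_gt0.
have s0 : Num.sqrt (2 * pi * v) != 0 by rewrite gt_eqF// sqrtr_gt0.
have v2 : 2 * v != 0 by rewrite mulf_neq0// gt_eqF.
have d1 : is_derive v 1 (fun v => 2 * pi * v) (2 * pi).
  by apply: (@is_derive_eq _ _ _ (fun v => (2 * pi) *: v)); rewrite [LHS]mulr1.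
have d2 : is_derive v 1 (fun v => 2 * v) 2.
  by apply: (@is_derive_eq _ _ _ (fun v => 2 *: v)); rewrite [LHS]mulr1.
have dsq : is_derive v 1 (fun v => Num.sqrt (2 * pi * v))
    ((2 * Num.sqrt (2 * pi * v))^-1 * (2 * pi)).
  have ? := is_derive1_sqrt cv0.
  exact: is_derive1_comp.
have dV := @is_deriveV _ (fun v => Num.sqrt (2 * pi * v)) v _ 1 s0 dsq.
have dW := @is_deriveV _ (fun v => 2 * v) v _ 1 v2 d2.
apply: is_derive_eq; rewrite /GRing.scale/=.
(* Eliminating [pi] in favour of the square root leaves an identity of rational functions for
   [field]. *)
have piE : pi = (Num.sqrt (2 * pi * v)) ^+ 2 / (2 * v) :> R.
  by rewrite sqr_sqrtr ?ltW//; field; rewrite gt_eqF.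
move: (Num.sqrt _) s0 piE => s s0 piE; rewrite piE; field.
by rewrite s0 gt_eqF.
Qed.

Lemma is_derive_gauss_jet (R : realType) n (v z : R) : 0 < v ->
  is_derive z 1 (gauss_jet n v) (- gauss_jet n.+1 v z).
Proof.
move=> v0; elim/ltn_ind: n => -[_|[_|n IH]].
- have -> : gauss_jet 0 v = gauss v.
    by apply/funext => y; rewrite gauss_jet0.
  exact: is_derive_gauss.
- have -> : gauss_jet 1 v = (fun z => v^-1 * (z * gauss v z)).
    by apply/funext => y; rewrite gauss_jet1.
  have ? := is_derive_gauss z v0.
  apply: is_derive_eq; rewrite gauss_jetSS gauss_jet1 gauss_jet0.
  by rewrite /GRing.scale/=; field; rewrite gt_eqF.
have ? := IH n.+1 (ltnSn _).
have ? := IH n (ltnW (ltnSn _)).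
rewrite (_ : gauss_jet n.+2 v =
    (fun z => v^-1 * (z * gauss_jet n.+1 v z - n.+1%:R * gauss_jet n v z))).
  apply: is_derive_eq; rewrite /GRing.scale/= (gauss_jetSS n.+1) -(natr1 n.+1).
  by field; rewrite gt_eqF.
by apply/funext => y; rewrite gauss_jetSS.
Qed.

(** The heat equation passes to all jets through the three-term recurrence, hence the strong
    induction over two predecessors. *)
Lemma is_derive_gauss_jet_var (R : realType) n (v z : R) : 0 < v ->
  is_derive v 1 (fun v => gauss_jet n v z) (gauss_jet n.+2 v z / 2).
Proof.
move=> v0; have dW := @is_deriveV _ id v _ 1 (lt0r_neq0 v0) (is_derive_id _ _).
elim/ltn_ind: n => -[_|[_|n IH]].
- rewrite (_ : (fun v => _) = (fun v => gauss v z)).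
    exact: is_derive_gauss_var.
  by apply/funext => y; rewrite gauss_jet0.
- rewrite (_ : (fun v => _) = (fun v => v^-1 * (z * gauss v z))).
    have ? := is_derive_gauss_var z v0.
    apply: is_derive_eq; rewrite /GRing.scale/= !gauss_jetSS gauss_jet1 gauss_jet0.
    by field; rewrite gt_eqF.
  by apply/funext => y; rewrite gauss_jet1.
have ? := IH n.+1 (ltnSn _).
have ? := IH n (ltnW (ltnSn _)).
rewrite (_ : (fun v => _) =
    (fun v => v^-1 * (z * gauss_jet n.+1 v z - n.+1%:R * gauss_jet n v z))).
  apply: is_derive_eq; rewrite /GRing.scale/= (gauss_jetSS n.+2) (gauss_jetSS n.+1).
  rewrite (gauss_jetSS n) -(natr1 n.+2) -(natr1 n.+1).
  by field; rewrite gt_eqF.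
by apply/funext => y; rewrite gauss_jetSS.
Qed.

(** The bound is uniform in [v >= u], as Taylor remainders need derivatives at intermediate
    variances. *)
Lemma gauss_jet_bounded (R : realType) n (B u : R) : 0 < u ->
  exists2 C : R, 0 < C &
    forall v z, u <= v -> `|z| <= B -> `|gauss_jet n v z| <= C.
Proof.
move=> u0; have [B0|B0] := leP 0 B; last first.
  by exists 1 => // v z _ zB; have := le_lt_trans zB B0; rewrite normr_lt0.
have Vb v : u <= v -> `|v^-1| <= u^-1.
  move=> uv; have v0 := lt_le_trans u0 uv.
  by rewrite ger0_norm ?lef_pV2 ?posrE// invr_ge0 ltW.
have G0 : exists2 C : R, 0 < C & forall v z, u <= v -> `|z| <= B -> `|gauss v z| <= C.
  exists (Num.sqrt (2 * pi * u))^-1.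
    by rewrite invr_gt0 sqrtr_gt0 !mulr_gt0 ?pi_gt0.
  move=> v z uv _; rewrite gtr0_norm ?gauss_le// gauss_gt0//.
  exact: lt_le_trans uv.
elim/ltn_ind: n => -[_|[_|n IH]].
- by have [C C0 H] := G0; exists C => // v z uv zB; rewrite gauss_jet0 H.
- have [C C0 H] := G0; exists (u^-1 * (B * C + 1)).
    by rewrite mulr_gt0 ?invr_gt0// ltr_wpDl// mulr_ge0// ltW.
  move=> v z uv zB; rewrite gauss_jet1 normrM (normrM z).
  apply: ler_pM; rewrite ?mulr_ge0// ?Vb//.
  by rewrite ler_wpDr// ler_pM// H.
have [C C0 H] := IH n.+1 (ltnSn _).
have [C' C'0 H'] := IH n (ltnW (ltnSn _)).
exists (u^-1 * (B * C + n.+1%:R * C')).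
  by rewrite mulr_gt0 ?invr_gt0// ltr_wpDl ?mulr_gt0// mulr_ge0// ltW.
move=> v z uv zB; rewrite gauss_jetSS normrM.
apply: ler_pM => //; first exact: Vb.
rewrite (le_trans (ler_normB _ _))// (normrM z) (normrM n.+1%:R) normr_nat.
by rewrite lerD// ler_pM// ?H ?H'.
Qed.

(** The successive derivatives are supplied as the family [h]. The induction bounds the remainder of
    the derivative [h 1], and the mean value theorem adds the last factor [|t|]; the factor [1 / n!]
    is given up. *)
Lemma taylor_bound (R : realType) (n : nat) (h : nat -> R -> R) (t C : R) :
  (forall k (s : R), (k < n)%N -> `|s| <= `|t| -> is_derive s 1 (h k) (h k.+1 s)) ->
  (forall s : R, `|s| <= `|t| -> `|h n s| <= C) ->
  `|h 0 t - \sum_(k < n) t ^+ k / k`!%:R * h k 0| <= C * `|t| ^+ n.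
Proof.
elim: n h t => [|n IH] h t dh hC.
  by rewrite big_ord0 subr0 expr0 mulr1 hC.
pose P : {poly R} := \poly_(j < n.+1) (h j 0 / j`!%:R).
have PE s : P.[s] = \sum_(j < n.+1) s ^+ j / j`!%:R * h j 0.
  by rewrite horner_poly; apply: eq_bigr => j _; ring.
have P'E s : P^`().[s] = \sum_(j < n) s ^+ j / j`!%:R * h j.+1 0.
  rewrite (_ : P^`() = \poly_(j < n) (h j.+1 0 / j`!%:R)).
    by rewrite horner_poly; apply: eq_bigr => j _; ring.
  apply/polyP => j; rewrite coef_deriv !coef_poly ltnS; case: ifP => [_|_]; last by rewrite mul0rn.
  rewrite factS natrM -mulr_natr; field.
  by rewrite nat1r !pnatr_eq0 -!lt0n fact_gt0.
have dg (s : R) : `|s| <= `|t| -> is_derive s 1 (fun s => h 0%N s - P.[s]) (h 1%N s - P^`().[s]).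
  move=> st; have ? := dh 0%N s (ltn0Sn _) st.
  exact: is_deriveB.
have bd (s : R) : `|s| <= `|t| -> `|h 1%N s - P^`().[s]| <= C * `|t| ^+ n.
  move=> st; rewrite P'E (le_trans (IH (fun k => h k.+1) s _ _))//.
  - by move=> k x kn xs; apply: dh => //; exact: le_trans st.
  - by move=> x xs; apply: hC; exact: le_trans st.
  - rewrite ler_wpM2l ?lerXn2r ?nnegrE//.
    by apply: le_trans (hC 0 _); rewrite ?normr0.
rewrite -PE exprSr mulrA.
have r0 : h 0%N 0 - P.[0] = 0.
  rewrite PE big_ord_recl/= expr0 fact0 divr1 mul1r big1 ?addr0 ?subrr// => j _.
  by rewrite /= exprS !mul0r.
have cont (a b : R) : (forall s : R, s \in `[a, b] -> `|s| <= `|t|) ->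
    {within `[a, b], continuous (fun s => h 0%N s - P.[s])}.
  move=> ab; apply: derivable_within_continuous => s /ab st.
  by have [] := dg s st.
have [t0|t0] := leP 0 t.
  have sub s : s \in `[0, t] -> `|s| <= `|t|.
    by rewrite in_itv/= => /andP[s0 st]; rewrite !ger0_norm.
  have dt x : x \in `]0, t[ -> is_derive x 1 (fun s => h 0%N s - P.[s])
      (h 1%N x - P^`().[x]).
    by move=> xt; apply/dg/sub; exact: subset_itv_oo_cc xt.
  have [c ct] := MVT_segment t0 dt (cont _ _ sub).
  rewrite r0 !subr0 => ->; rewrite normrM ler_wpM2r//.
  exact/bd/sub.
have sub s : s \in `[t, 0] -> `|s| <= `|t|.
  by rewrite in_itv/= => /andP[s0 st]; rewrite !ler0_norm ?lerN2// ltW.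
have dt x : x \in `]t, 0[ -> is_derive x 1 (fun s => h 0%N s - P.[s])
    (h 1%N x - P^`().[x]).
  by move=> xt; apply/dg/sub; exact: subset_itv_oo_cc xt.
have [c ct] := MVT_segment (ltW t0) dt (cont _ _ sub).
rewrite r0 !sub0r => /(congr1 Num.norm); rewrite normrN => ->.
rewrite normrM normrN ler_wpM2r//.
exact/bd/sub.
Qed.

(** * The normal distribution function and its derivatives *)

Lemma std_pdf_gauss (R : realType) : std_pdf (R := R) = gauss 1.
Proof. by apply/funext => x; rewrite std_pdfE /gauss !mulr1. Qed.

Lemma continuous_std_pdf (R : realType) : continuous (@std_pdf R).
Proof. exact: continuous_normal_pdf. Qed.

Lemma integrable_std_pdf (R : realType) (A : set R) : measurable A ->
  lebesgue_measure.-integrable A (EFin \o @std_pdf R).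
Proof.
move=> mA; 
by apply: integrableS (@integrable_normal_pdf R 0 1) => //; exact: measurableT.
Qed.

Lemma std_cdf_ge0 (R : realType) (x : R) : 0 <= std_cdf x.
Proof. by apply: Rintegral_ge0 => y _; exact: normal_pdf_ge0. Qed.

Lemma std_cdf_le1 (R : realType) (x : R) : std_cdf x <= 1.
Proof.
rewrite -[leRHS]/(fine 1%E) -(@integral_normal_pdf R 0 1) /std_cdf /Rintegral.
apply: fine_le.
- by apply: integrable_fin_num => //; exact: integrable_std_pdf.
- by rewrite integral_normal_pdf.
- apply: ge0_subset_integral => //.
    by apply/measurable_realfun.measurable_EFinP; exact: measurable_normal_pdf.
  by move=> y _; rewrite lee_fin normal_pdf_ge0.
Qed.

Lemma is_derive_std_cdf (R : realType) (x : R) :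
  is_derive x 1 (@std_cdf R) (gauss 1 x).
Proof.
have [] := @continuous_FTC1 R (@std_pdf R) -oo%O x (x + 1).
- by rewrite ltrDl.
- exact: integrable_std_pdf.
- exact: ltNyr.
- exact: continuous_std_pdf.
by rewrite -std_pdf_gauss derive1E => d <-; exact: derivableP.
Qed.

Lemma std_cdf_lt (R : realType) : {homo @std_cdf R : x y / x < y}.
Proof.
move=> x y xy; have [|c _ E] := MVT xy (fun z _ => is_derive_std_cdf z).
  by apply: derivable_within_continuous => z _; have [] := is_derive_std_cdf z.
by rewrite -subr_gt0 E mulr_gt0 ?subr_gt0// gauss_gt0.
Qed.

Lemma std_cdf_gt0 (R : realType) (x : R) : 0 < std_cdf x.
Proof.
by apply: le_lt_trans (std_cdf_ge0 (x - 1)) (std_cdf_lt _); rewrite ltrBlDr ltrDl.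
Qed.

Lemma skew_pdfE (R : realType) (theta v m x : R) : 0 < v ->
  skew_pdf theta (Num.sqrt v) m x =
  2 * (gauss v (x - theta) * std_cdf (m / Num.sqrt v * (x - theta))).
Proof.
move=> v0; rewrite /skew_pdf std_pdf_gauss.
have -> : gauss v (x - theta) = (Num.sqrt v)^-1 * gauss 1 ((x - theta) / Num.sqrt v).
  rewrite /gauss !mulr1 exprMn exprVn sqr_sqrtr ?ltW// invfM mulrA.
  rewrite [Num.sqrt (_ * v)]sqrtrM ?mulr_ge0 ?pi_ge0// invfM.
  by congr (_ * expR (- _)); [exact: mulrC|ring].
by rewrite -(mulrA m) (mulrC (x - theta)) mulrA !mulrA.
Qed.

(** The [n]-th derivative of [std_cdf]; the explicit sign undoes the one absorbed in [gauss_jet]. *)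
Definition cdf_jet (R : realType) (n : nat) (z : R) : R :=
  if n is m.+1 then (-1) ^+ m * gauss_jet m 1 z else std_cdf z.

Lemma is_derive_cdf_jet (R : realType) n (z : R) :
  is_derive z 1 (cdf_jet n) (cdf_jet n.+1 z).
Proof.
case: n => [|n] /=.
  by rewrite expr0 mul1r gauss_jet0; exact: is_derive_std_cdf.
have ? := is_derive_gauss_jet n z ltr01.
apply: is_derive_eq; rewrite /GRing.scale/= exprS; ring.
Qed.

Lemma cdf_jet_bounded (R : realType) n (B : R) :
  exists2 C : R, 0 < C & forall z, `|z| <= B -> `|cdf_jet n z| <= C.
Proof.
case: n => [|n].
  exists 1 => // z _; rewrite ger0_norm ?std_cdf_ge0//; exact: std_cdf_le1.
have [C C0 H] := gauss_jet_bounded n B ltr01.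
exists C => // z zB; rewrite normrM normrX normrN1 expr1n mul1r; exact: H.
Qed.

(** * Linear independence *)

(** In both cases the exponent eventually dominates a linear function [d * x] with [d > 0], and the
    exponential series beats any power. *)
Lemma poly_exp_small (R : realType) (p : {poly R}) (al be e : R) : 0 < e ->
  0 < al \/ al = 0 /\ 0 < be ->
  \forall x \near +oo, `|p.[x]| * expR (- (al * x ^+ 2 + be * x)) <= e.
Proof.
move=> e0 ab; set n := size p.
pose C := \sum_(i < n) `|p`_i|.
have C0 : 0 <= C by apply: sumr_ge0.
have pC x : 1 <= x -> `|p.[x]| <= C * x ^+ n.
  move=> x1; rewrite horner_coef (le_trans (ler_norm_sum _ _ _))// mulr_suml.
  apply: ler_sum => i _; rewrite normrM normrX (ger0_norm (le_trans ler01 x1)).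
  by rewrite ler_wpM2l// ler_weXn2l// ltnW.
have [d d0 dP] : exists2 d : R, 0 < d &
    \forall x \near +oo, d * x <= al * x ^+ 2 + be * x.
  case: ab => [al0|[-> be0]].
    exists 1 => //; near=> x.
    have x0 : 0 < x by near: x; exact: nbhs_pinfty_gt.
    rewrite expr2 mulrA -mulrDl ler_pM2r// -lerBlDr mulrC -ler_pdivrMr//.
  by exists be => //; near=> x; rewrite mul0r add0r.
pose K := C * n.+1`!%:R / d ^+ n.+1.
near=> x.
have x1 : 1 <= x by near: x; exact: nbhs_pinfty_ge.
have x0 : 0 < x by exact: lt_le_trans x1.
have dx0 : 0 < d * x by rewrite mulr_gt0.
have E : expR (- (al * x ^+ 2 + be * x)) <= n.+1`!%:R / (d * x) ^+ n.+1.
  rewrite (@le_trans _ _ (expR (- (d * x))))//.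
    by rewrite ler_expR lerN2; near: x.
  rewrite expRN -[leRHS]invf_div lef_pV2 ?posrE ?expR_gt0//; last first.
    by rewrite divr_gt0 ?exprn_gt0// ltr0n fact_gt0.
  by rewrite (le_trans _ (expR_ge1Dxn n (ltW dx0)))// lerDr.
rewrite (le_trans (ler_pM _ _ (pC x x1) E)) ?expR_ge0//.
have -> : C * x ^+ n * (n.+1`!%:R / (d * x) ^+ n.+1) = K / x.
  rewrite /K exprMn [x ^+ n.+1]exprSr; field.
  by rewrite !gt_eqF ?exprn_gt0.
by rewrite ler_pdivrMr// mulrC -ler_pdivrMr.
Unshelve. all: by end_near. Qed.

Lemma poly_lower_bound_pinfty (R : realType) (p : {poly R}) : p != 0 ->
  exists2 c : R, 0 < c & \forall x \near +oo, c <= `|p.[x]|.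
Proof.
move=> p0.
have H (q : {poly R}) : 0 < lead_coef q ->
    \forall x \near +oo, lead_coef q <= `|q.[x]|.
  move=> /polyrcf.poly_pinfty_gt_lc[n nP].
  apply: filterS (nbhs_pinfty_ge (num_real n)) => x nx.
  by rewrite (le_trans (nP x nx)) ?ler_norm.
have [l0|l0|/eqP] := ltgtP 0 (lead_coef p).
- by exists (lead_coef p) => //; exact: H.
- exists (- lead_coef p); rewrite ?oppr_gt0//.
  have := H (- p); rewrite lead_coefN oppr_gt0 => /(_ l0).
  by apply: filterS => x; rewrite hornerN normrN.
- by rewrite eq_sym lead_coef_eq0 (negbTE p0).
Qed.

(** Dividing by the [k]-th Gaussian makes all other terms vanish at infinity, while the [k]-th stays
    bounded below unless its polynomial is zero. *)
Lemma gaussian_sum_dominant (R : realType) (I : finType) (ka t : I -> R)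
    (p : I -> {poly R}) (g : I -> R -> R) (k : I) (c : R) :
  0 < c -> 0 < ka k -> (forall i x, `|g i x| <= 1) ->
  (\forall x \near +oo, c <= g k x) ->
  (forall i, i != k -> p i != 0 ->
     ka k < ka i \/ ka i = ka k /\ t i < t k) ->
  (forall x, \sum_i (p i).[x] * expR (- (ka i / 2 * (x - t i) ^+ 2)) * g i x = 0) ->
  p k = 0.
Proof.
move=> c0 kk g1 gk dom sum0; apply/eqP/negPn/negP => pk0.
have [c' c'0 pk] := poly_lower_bound_pinfty pk0.
(* Fewer than [#|I|.+1] terms, each at most [e], add up to less than [c * c']. *)
pose e := c * c' / 2 / #|I|.+1%:R.
have e0 : 0 < e by rewrite !divr_gt0// mulr_gt0.
(* Expanding the squares, the [i]-th Gaussian is the [k]-th one times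
   [d i * expR (- (a i * x ^+ 2 + b i * x))]. *)
pose a i := (ka i - ka k) / 2.
pose b i := ka k * t k - ka i * t i.
pose d i := expR (- (ka i * t i ^+ 2 - ka k * t k ^+ 2) / 2).
have small : \forall x \near +oo, forall i, i != k ->
    `|(d i *: p i).[x]| * expR (- (a i * x ^+ 2 + b i * x)) <= e.
  apply: filter_forall => i; have [->|ik] := eqVneq i k.
    by near=> x.
  have [pi0|pi0] := eqVneq (p i) 0.
    by near=> x; rewrite pi0 scaler0 horner0 normr0 mul0r ltW.
  have H : \forall x \near +oo, `|(d i *: p i).[x]| * expR (- (a i * x ^+ 2 + b i * x)) <= e.
    apply: poly_exp_small => //; rewrite /a /b.
    case: (dom i ik pi0) => [kl|[-> tl]]; [left|right].
      by rewrite divr_gt0// subr_gt0.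
    by rewrite subrr mul0r -mulrBr; split=> //; rewrite mulr_gt0// subr_gt0.
  by apply: filterS H.
near (pinfty_nbhs R) => x.
have gx : c <= g k x by near: x.
have px : c' <= `|(p k).[x]| by near: x.
have sx : forall i, i != k ->
    `|(d i *: p i).[x]| * expR (- (a i * x ^+ 2 + b i * x)) <= e by near: x.
have expE i : expR (- (ka i / 2 * (x - t i) ^+ 2)) =
    expR (- (ka k / 2 * (x - t k) ^+ 2)) *
    (d i * expR (- (a i * x ^+ 2 + b i * x))).
  by rewrite /d -!expRD; congr expR; rewrite /a /b; field.
have : (p k).[x] * g k x =
    - \sum_(i | i != k) (d i *: p i).[x] * expR (- (a i * x ^+ 2 + b i * x)) * g i x.
  apply: (mulfI (lt0r_neq0 (expR_gt0 (- (ka k / 2 * (x - t k) ^+ 2))))).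
  have := sum0 x; rewrite (bigD1 k)//= => /eqP; rewrite addr_eq0 => /eqP H.
  rewrite mulrA [_ * (p k).[x]]mulrC H mulrN; congr (- _).
  by rewrite mulr_sumr; apply: eq_bigr => i ik; rewrite (expE i) hornerZ; ring.
move=> /(congr1 Num.norm); rewrite normrN => H.
have : c * c' <= e * #|I|%:R.
  rewrite (@le_trans _ _ (`|(p k).[x] * g k x|))//.
    rewrite normrM mulrC ler_pM// ?(ltW c0) ?(ltW c'0)//.
    by rewrite (le_trans gx)// ler_norm.
  rewrite H (le_trans (ler_norm_sum _ _ _))//.
  rewrite (@le_trans _ _ (\sum_(i | i != k) e))//.
    apply: ler_sum => i ik; rewrite normrM -[leRHS]mulr1 ler_pM//.
    by rewrite normrM [`|expR _|]ger0_norm ?expR_ge0// sx.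
  rewrite big_const iter_addr_0 -[e *+ _]mulr_natr ler_pM2l// ler_nat; exact: max_card.
apply/negP; rewrite -ltNge.
have -> : c * c' = e * (2 * #|I|.+1%:R).
  by rewrite /e; field; rewrite nat1r pnatr_eq0.
by rewrite ltr_pM2l// -natrM ltr_nat mul2n -addnn ltn_addl.
Unshelve. all: by end_near. Qed.

(** Reflection of the previous lemma. It reverses the order of the locations, so domination is asked
    through [ka] alone. *)
Lemma gaussian_sum_dominant_ninfty (R : realType) (I : finType) (ka t : I -> R)
    (p : I -> {poly R}) (g : I -> R -> R) (k : I) (c : R) :
  0 < c -> 0 < ka k -> (forall i x, `|g i x| <= 1) ->
  (\forall x \near +oo, c <= g k (- x)) ->
  (forall i, i != k -> p i != 0 -> ka k < ka i) ->
  (forall x, \sum_i (p i).[x] * expR (- (ka i / 2 * (x - t i) ^+ 2)) * g i x = 0) ->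
  p k = 0.
Proof.
move=> c0 kk g1 gk dom sum0.
have np i : (p i \Po - 'X == 0) = (p i == 0).
  by rewrite comp_poly_eq0// size_polyN size_polyX.
apply/eqP; rewrite -np; apply/eqP.
apply: (@gaussian_sum_dominant R I ka (fun i => - t i)
  (fun i => p i \Po - 'X) (fun i x => g i (- x)) k c) => //.
  by move=> i ik; rewrite np => pi0; left; exact: dom.
move=> x; rewrite -[RHS](sum0 (- x)); apply: eq_bigr => i _.
rewrite horner_comp hornerN hornerX opprK; congr (_ * expR (- (_ * _)) * _).
by ring.
Qed.

(** The inverse variance [v^-1 + l ^+ 2] of the product is [(1 + m ^+ 2) / sigma ^+ 2], the inverse
    of the first component of [cousin_key]. This is how the hypotheses on [G0] become statements
    about exponents. *)
Lemma gauss_mul (R : realType) (v l z : R) : 0 < v ->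
  gauss v z * gauss 1 (l * z) =
  (Num.sqrt (2 * pi * v))^-1 * (Num.sqrt (2 * pi))^-1 *
    expR (- ((v^-1 + l ^+ 2) / 2 * z ^+ 2)).
Proof.
move=> v0; rewrite /gauss !mulr1 mulrACA -expRD; congr (_ * expR _).
by field; rewrite gt_eqF.
Qed.

(* At the lexicographically dominant pair (inverse variance, location) among the
   terms with a non-zero polynomial, one tail of the sum is asymptotic to a single
   term: the tail is chosen so that the factor [std_cdf] stays bounded below. *)
Lemma skew_terms_independent (R : realType) (n : nat) (th v lam : 'I_n -> R)
    (P Q : 'I_n -> {poly R}) :
  (forall i, 0 < v i) -> injective v ->
  (forall i, lam i != 0) ->
  (forall i j, (v i)^-1 + lam i ^+ 2 != (v j)^-1) ->
  (forall i j, (v i)^-1 + lam i ^+ 2 = (v j)^-1 + lam j ^+ 2 ->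
     th i = th j -> i = j) ->
  (forall x, \sum_i gauss (v i) (x - th i) *
     ((P i).[x - th i] * std_cdf (lam i * (x - th i)) +
      (Q i).[x - th i] * gauss 1 (lam i * (x - th i))) = 0) ->
  forall i, P i = 0 /\ Q i = 0.
Proof.
move=> v0 vI lam0 conf distinct sum0.
(* Left summands carry [std_cdf]; right ones are pure Gaussians, by [gauss_mul]. In both, [ka] is
   the inverse variance that governs the decay. *)
pose I : finType := ('I_n + 'I_n)%type.
pose ka (k : I) := match k with inl i => (v i)^-1 | inr i => (v i)^-1 + lam i ^+ 2 end.
pose t (k : I) := match k with inl i => th i | inr i => th i end.
pose c i := (Num.sqrt (2 * pi * v i))^-1.
have c_neq0 i : c i != 0.
  by rewrite invr_eq0 gt_eqF// sqrtr_gt0 !mulr_gt0 ?pi_gt0.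
pose c1 : R := (Num.sqrt (2 * pi))^-1.
have c1_neq0 : c1 != 0 by rewrite invr_eq0 gt_eqF// sqrtr_gt0 mulr_gt0 ?pi_gt0.
pose p (k : I) := match k with
  | inl i => c i *: (P i \Po ('X - (th i)%:P))
  | inr i => (c i * c1) *: (Q i \Po ('X - (th i)%:P)) end.
pose g (k : I) x := match k with
  | inl i => std_cdf (lam i * (x - th i)) | inr i => 1 end.
have ka0 k : 0 < ka k.
  case: k => i /=; rewrite ?invr_gt0// ltr_pwDl ?invr_gt0// sqr_ge0//.
have g1 k x : `|g k x| <= 1.
  case: k => i /=; last by rewrite normr1.
  by rewrite ger0_norm ?std_cdf_ge0 ?std_cdf_le1.
have sumI x : \sum_k (p k).[x] * expR (- (ka k / 2 * (x - t k) ^+ 2)) * g k x = 0.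
  rewrite -[RHS](sum0 x) big_sumType/= -big_split/=; apply: eq_bigr => i _.
  rewrite (mulrDr (gauss _ _)) !hornerZ !horner_comp !hornerXsubC.
  rewrite [_ * (_ * gauss 1 _)]mulrCA gauss_mul//.
  congr (_ + _); rewrite /gauss.
    have -> : (v i)^-1 / 2 * (x - th i) ^+ 2 = (x - th i) ^+ 2 / (2 * v i).
      by field; rewrite gt_eqF.
    by rewrite /c; ring.
  by rewrite /c /c1; ring.
suff p0 k : p k = 0.
  move=> i; split; apply/eqP.
    have /eqP := p0 (inl i); rewrite /= scaler_eq0 (negbTE (c_neq0 i))/=.
    by rewrite comp_poly_eq0// size_XsubC.
  have /eqP := p0 (inr i); rewrite /= scaler_eq0 mulf_eq0.
  rewrite (negbTE (c_neq0 i)) (negbTE c1_neq0)/=.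
  by rewrite comp_poly_eq0// size_XsubC.
apply/eqP/negPn/negP => pk0.
(* Slowest decay first, then, among ties, the largest location. *)
case: (@Order.TotalTheory.arg_minP _ _ _ k (fun k => p k != 0) ka pk0) => k1 pk1 min1.
have pk1' : (p k1 != 0) && (ka k1 == ka k1) by rewrite pk1 eqxx.
case: (@Order.TotalTheory.arg_maxP _ _ _ k1
  (fun k => (p k != 0) && (ka k == ka k1)) t pk1') => k2 /andP[pk2 /eqP k21] max2.
have min2 j : p j != 0 -> ka k2 <= ka j by rewrite k21; exact: min1.
have max2' j : p j != 0 -> ka j = ka k2 -> t j <= t k2.
  by move=> pj e; apply: max2; rewrite pj e k21 eqxx.
have ph0 := std_cdf_gt0 (0 : R).
case: k2 => [i|i] in pk2 k21 max2 min2 max2'.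
  (* A term with [std_cdf] has no rival at its inverse variance: [conf] excludes the pure Gaussians
     and injectivity of [v] the other terms. Either tail is then available. *)
  have strict j : j != inl i -> p j != 0 -> ka (inl i) < ka j.
    move=> ji pj; rewrite lt_neqAle min2// andbT.
    case: j ji pj => j ji pj /=; last by rewrite eq_sym conf.
    apply: contra ji => /eqP /invr_inj /vI ->; exact: eqxx.
  have /eqP := pk2; apply.
  have [l0|l0|/eqP] := ltgtP 0 (lam i).
  - apply: (gaussian_sum_dominant ph0 (ka0 (inl i)) g1 _ _ sumI).
      apply: filterS (nbhs_pinfty_ge (num_real (th i))) => x xt.
      rewrite /g; have [->//|h] := eqVneq (lam i * (x - th i)) 0.
      apply/ltW/std_cdf_lt; rewrite lt_neqAle eq_sym h.
      by rewrite (mulr_ge0 (ltW l0))// subr_ge0.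
    by move=> j ji pj; left; exact: strict.
  - apply: (gaussian_sum_dominant_ninfty ph0 (ka0 (inl i)) g1 _ strict sumI).
    apply: filterS (nbhs_pinfty_ge (num_real (- th i))) => x xt.
    rewrite /g; have [->//|h] := eqVneq (lam i * (- x - th i)) 0.
    apply/ltW/std_cdf_lt; rewrite lt_neqAle eq_sym h.
    by rewrite (mulr_le0 (ltW l0))// subr_le0 lerNl.
  - by rewrite eq_sym (negbTE (lam0 i)).
have /eqP := pk2; apply.
(* Ties are possible here, but only with pure Gaussians at other locations; the largest location
   wins at [+oo]. *)
apply: (gaussian_sum_dominant ltr01 (ka0 (inr i)) g1 _ _ sumI).
  by near=> x.
move=> j ji pj.
have := min2 j pj; rewrite le_eqVlt => /orP[/eqP e|]; last by left.
right; split; first by [].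
rewrite lt_neqAle max2'// andbT.
case: j ji pj e => j ji pj /= e.
  by have := conf i j; rewrite e eqxx.
apply: contra ji => /eqP tt; apply/eqP; congr inr.
by apply: distinct => //; rewrite e.
Unshelve. all: by end_near. Qed.

(** * Dual functionals *)

(* A finite subfamily of maximal rank spans everything, since a vector outside
   the span of that subfamily would enlarge it. *)
Lemma full_row_span (F : fieldType) (X : Type) (K : nat) (f : X -> 'rV[F]_K) :
  (forall c : 'cV[F]_K, (forall x, f x *m c = 0) -> c = 0) ->
  forall b : 'rV[F]_K, exists (n : nat) (xs : 'I_n -> X) (al : 'I_n -> F),
    b = \sum_l al l *: f (xs l).
Proof.
move=> indep b.
pose M n (xs : 'I_n -> X) := \matrix_l f (xs l).
pose P r := `[< exists n (xs : 'I_n -> X), \rank (M n xs) = r >].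
have exP : exists r, P r.
  by exists (\rank (M 0%N (fun i => match i with Ordinal _ h => match notF h with end end))); apply/asboolP; do 2 eexists.
have ubP r : P r -> (r <= K)%N by move=> /asboolP[n [xs <-]]; exact: rank_leq_col.
case: (ex_maxnP exP ubP) => r /asboolP[n [xs rE]] rmax.
have full : row_full (M n xs).
  rewrite -[row_full _]negbK; apply/negP => nfull.
  (* Such a column is a non-zero relation satisfied by all rows chosen so far; by independence some
     [f x] violates it, and adding that row raises the rank. *)
  have [j cj] : exists j, col j (cokermx (M n xs)) != 0.
    apply: contrapT => /forallNP h; move: nfull.
    rewrite -cokermx_eq0 => /negP; apply; apply/eqP/matrixP => i j.
    have /negP := h j; rewrite negbK => /eqP /matrixP /(_ i 0).
    by rewrite !mxE.
  have [x fx] : exists x, f x *m col j (cokermx (M n xs)) != 0.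
    apply: contrapT => /forallNP h; case/eqP : cj; apply: indep => x.
    by have /negP := h x; rewrite negbK => /eqP.
  pose xs' (i : 'I_(n + 1)) := match fintype.split i with inl i => xs i | inr _ => x end.
  have ME : M (n + 1)%N xs' = col_mx (M n xs) (f x).
    apply/row_matrixP => i; rewrite rowK /xs'.
    case: (splitP i) => k ik.
      have -> : i = lshift 1 k by exact: val_inj.
      by rewrite rowKu rowK.
    have -> : i = rshift n k by exact: val_inj.
    by rewrite rowKd ord1 row_id.
  have : (\rank (M (n + 1)%N xs') <= r)%N by apply: rmax; apply/asboolP; do 2 eexists.
  rewrite leqNgt => /negP; apply; rewrite -rE ME.
  apply: rank_ltmx; rewrite ltmxE col_mx_sub submx_refl /= -addsmxE addsmxSl /=.
  apply: contra fx => /submxP[D ->].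
  by rewrite colE mulmxA -(mulmxA D) mulmx_coker mulmx0 mul0mx.
have /submxP[D ->] : (b <= M n xs)%MS by exact: submx_full.
exists n, xs, (D 0); rewrite mulmx_sum_row.
by apply: eq_bigr => l _; rewrite rowK.
Qed.

Lemma continuous_integrable_itv (R : realType) (g : R -> R) (u w : R) :
  continuous g -> lebesgue_measure.-integrable `[u, w] (EFin \o g).
Proof.
move=> cg; apply: continuous_compact_integrable; first exact: segment_compact.
exact: continuous_subspaceT.
Qed.

(** Hence integrals over segments suffice as test functionals on continuous functions. *)
Lemma itv_integrals_eq0 (R : realType) (g : R -> R) : continuous g ->
  (forall u w, \int[lebesgue_measure]_(x in `[u, w]) g x = 0) -> forall x, g x = 0.
Proof.
move=> cg int0 x.
have [] := @continuous_FTC1_closed R g (x - 1) x (x + 1).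
- by rewrite ltrDl.
- exact: continuous_integrable_itv.
- by rewrite ltrBlDr ltrDl.
- exact: cg.
move=> _ <-; rewrite (_ : (fun y => _) = cst 0) ?derive1_cst//.
by apply/funext => y; exact: int0.
Qed.

Lemma itv_integral_le_sup (R : realType) (g : R -> R) (u w M e : R) :
  continuous g -> `|u| <= M -> `|w| <= M ->
  (forall x, `|x| <= M -> `|g x| <= e) ->
  `|\int[lebesgue_measure]_(x in `[u, w]) g x| <=
    e * fine (@lebesgue_measure R `[u, w]).
Proof.
move=> cg uM wM ge.
have ig := continuous_integrable_itv u w cg.
rewrite (le_trans (le_normr_Rintegral _ _))// -Rintegral_cst//.
apply: le_Rintegral => //.
- by apply: continuous_integrable_itv => x; apply: continuous_comp;
    [exact: cg|exact: norm_continuous].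
- by apply: continuous_integrable_itv; exact: cst_continuous.
- move=> x /=; rewrite in_itv/= => /andP[ux xw]; apply: ge.
  move: uM wM; rewrite !ler_norml => /andP[uM _] /andP[_ wM].
  by rewrite (le_trans uM ux) (le_trans xw wM).
Qed.

Lemma itv_integral_le_L1 (R : realType) (g : R -> R) (u w : R) :
  continuous g -> lebesgue_measure.-integrable setT (EFin \o g) ->
  `|\int[lebesgue_measure]_(x in `[u, w]) g x| <=
    \int[lebesgue_measure]_x `|g x|.
Proof.
move=> cg ig.
have ig' := continuous_integrable_itv u w cg.
have ng : lebesgue_measure.-integrable setT (EFin \o (fun x : R => `|g x|)).
  exact: (integrable_norm ig).
rewrite (le_trans (le_normr_Rintegral _ _))//.
apply: fine_le.
- by apply: integrable_fin_num => //; exact: (integrableS _ _ _ ng).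
- exact: integrable_fin_num.
- by apply: ge0_subset_integral => //; exact: measurable_int ng.
Qed.

(** By independence the vectors of segment integrals of the [B i] satisfy no common linear relation,
    so they span and any values [b] can be prescribed. The two bounds serve different ends: the
    supremum over a bounded set is for Taylor remainders, which are small only locally, and the [L1]
    norm is for the difference of the two mixtures. *)
Lemma dual_functional (R : realType) (I : finType) (B : I -> R -> R) (b : I -> R) :
  (forall i, continuous (B i)) ->
  (forall c : I -> R, (forall x, \sum_i c i * B i x = 0) -> forall i, c i = 0) ->
  exists (L : (R -> R) -> R) (C M : R),
    [/\ 0 < C,
        forall (a : R) (g h : R -> R), continuous g -> continuous h ->
          L (fun x => a * g x + h x) = a * L g + L h,
        forall (g : R -> R) (e : R), continuous g -> (forall x, `|x| <= M -> `|g x| <= e) ->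
          `|L g| <= C * e,
        forall g : R -> R, continuous g -> lebesgue_measure.-integrable setT (EFin \o g) ->
          `|L g| <= C * \int[lebesgue_measure]_x `|g x| &
        forall i, L (B i) = b i].
Proof.
move=> cB indep.
pose J (g : R -> R) (uw : R * R) := \int[lebesgue_measure]_(x in `[uw.1, uw.2]) g x.
have JP (a : R) (g h : R -> R) uw : continuous g -> continuous h ->
    J (fun x => a * g x + h x) uw = a * J g uw + J h uw.
  move=> cg ch; rewrite /J RintegralD//.
  - by rewrite RintegralZl//; exact: continuous_integrable_itv.
  - apply: continuous_integrable_itv => x.
    by apply: continuousM; [exact: cst_continuous|exact: cg].
  - exact: continuous_integrable_itv.
have Jsum (c : I -> R) uw (r : seq I) :
    continuous (fun x => \sum_(i <- r) c i * B i x) /\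
    J (fun x => \sum_(i <- r) c i * B i x) uw = \sum_(i <- r) c i * J (B i) uw.
  elim: r => [|i r [IHc IHJ]].
    rewrite big_nil; under eq_fun do rewrite big_nil; split.
      exact: cst_continuous.
    by rewrite /J Rintegral_cst// mul0r.
  rewrite big_cons; under eq_fun do rewrite big_cons; split.
    move=> x; apply: (@continuousD _ _ _ (fun x => c i * B i x)); last exact: IHc.
    by apply: continuousM; [exact: cst_continuous|exact: cB].
  by rewrite JP// IHJ.
pose f uw := \row_(k < #|I|) J (B (enum_val k)) uw.
have findep (c : 'cV[R]_#|I|) : (forall uw, f uw *m c = 0) -> c = 0.
  move=> fc.
  have c0 : forall i, c (enum_rank i) 0 = 0.
    apply: indep; apply: itv_integrals_eq0.
      by have [] := Jsum (fun i => c (enum_rank i) 0) (0, 0) (index_enum I).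
    move=> u w; have [_] := Jsum (fun i => c (enum_rank i) 0) (u, w) (index_enum I).
    rewrite /J => ->; have /matrixP /(_ 0 0) := fc (u, w).
    rewrite !mxE => H; rewrite -[RHS]H (reindex (@enum_rank I))/=; last first.
      exact/onW_bij/enum_rank_bij.
    by apply: eq_bigr => i _; rewrite mxE enum_rankK mulrC.
  by apply/matrixP => i j; rewrite ord1 mxE -[i]enum_valK c0.
have [n [xs [al H]]] := full_row_span findep (\row_k b (enum_val k)).
pose L g := \sum_l al l * J g (xs l).
(* [M] exceeds the absolute value of every endpoint, so [L] sees only the values on [[- M, M]]. *)
pose M := \sum_l (`|(xs l).1| + `|(xs l).2|).
have Msup l : `|(xs l).1| <= M /\ `|(xs l).2| <= M.
  have : `|(xs l).1| + `|(xs l).2| <= M.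
    by rewrite /M (bigD1 l)//= lerDl sumr_ge0// => i _; exact: addr_ge0.
  by move=> h; split; apply: le_trans h; rewrite ?lerDl ?lerDr.
pose m l := fine (@lebesgue_measure R `[(xs l).1, (xs l).2]).
have m0 l : 0 <= m l by exact: fine_ge0.
(* In [1 + m l], the length [m l] serves the supremum bound and the [1] serves the [L1] bound. *)
pose C := 1 + \sum_l `|al l| * (1 + m l).
have C0 : 0 <= \sum_l `|al l| * (1 + m l).
  by apply: sumr_ge0 => l _; rewrite mulr_ge0// addr_ge0.
have LC (g : R -> R) (e : R) : 0 <= e -> (forall l, `|J g (xs l)| <= (1 + m l) * e) -> `|L g| <= C * e.
  move=> e0 H'; rewrite (le_trans (ler_norm_sum _ _ _))// /C mulrDl mul1r.
  rewrite ler_wpDl// mulr_suml ler_sum// => l _.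
  by rewrite normrM -mulrA ler_wpM2l.
exists L, C, M; split.
- by rewrite ltr_pwDl.
- move=> a g h cg ch; rewrite /L mulr_sumr -big_split/=.
  by apply: eq_bigr => l _; rewrite JP//; ring.
- move=> g e cg ge.
  have e0 : 0 <= e.
    by apply: le_trans (ge 0 _); rewrite ?normr0// sumr_ge0// => l _; rewrite addr_ge0.
  apply: LC => // l; have [h1 h2] := Msup l.
  rewrite (le_trans (itv_integral_le_sup cg h1 h2 ge))// mulrC ler_wpM2r//.
  by rewrite lerDr.
- move=> g cg ig; apply: LC; first by apply: Rintegral_ge0.
  move=> l; rewrite (le_trans (itv_integral_le_L1 _ _ cg ig))//.
  by rewrite ler_peMl ?lerDl//; apply: Rintegral_ge0.
- move=> i; have /matrixP /(_ 0 (enum_rank i)) := H.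
  rewrite mxE enum_rankK => ->; rewrite summxE; apply: eq_bigr => l _.
  by rewrite !mxE enum_rankK.
Qed.

(** * Local expansion *)

Lemma is_derive_affine (R : realType) (a b x : R) :
  is_derive x 1 (fun x => a + b * x) b.
Proof.
apply: is_derive_eq. by rewrite add0r mul1r [LHS]mulr1.
Qed.

Lemma gauss_shift_taylor (R : realType) r (B u : R) : 0 < u ->
  exists2 C : R, 0 < C & forall v y s, u <= v -> `|y| <= B -> `|s| <= 1 ->
    `|gauss v (y - s) - \sum_(k < r.+1) s ^+ k / k`!%:R * gauss_jet k v y|
      <= C * `|s| ^+ r.+1.
Proof.
move=> u0; have [C C0 H] := gauss_jet_bounded r.+1 (B + 1) u0.
exists C => // v y s uv yB s1.
have v0 := lt_le_trans u0 uv.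
have -> : gauss v (y - s) = gauss_jet 0 v (y - s) by rewrite gauss_jet0.
rewrite [X in _ - X](_ : _ =
    \sum_(k < r.+1) s ^+ k / k`!%:R * gauss_jet k v (y - 0)).
  apply: (@taylor_bound _ r.+1 (fun k s => gauss_jet k v (y - s))).
    move=> k x _ _.
    have d1 := is_derive_gauss_jet k (y - x) v0.
    have d2 : is_derive x 1 (fun x => y - x) (-1).
      by have := is_derive_affine y (-1) x; under eq_fun do rewrite mulN1r.
    have := @is_derive1_comp _ (gauss_jet k v) (fun x => y - x) x _ _ d1 d2.
    by rewrite mulrN1 opprK.
  move=> x xs; apply: H => //.
  by rewrite (le_trans (ler_normB _ _))// lerD// (le_trans xs).
by under [RHS]eq_bigr do rewrite subr0.
Qed.

(** With the increment written [2 * s], the factor one half of the heat equation cancels: each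
    derivative in [s] raises the order of the jet by exactly two. The bound on [s] keeps the
    variance above [v0 / 2]. *)
Lemma gauss_jet_var_taylor (R : realType) n r (B v0 : R) : 0 < v0 ->
  exists2 C : R, 0 < C & forall y s, `|y| <= B -> `|s| <= v0 / 4 ->
    `|gauss_jet n (v0 + 2 * s) y -
      \sum_(k < r.+1) s ^+ k / k`!%:R * gauss_jet (n + 2 * k) v0 y|
      <= C * `|s| ^+ r.+1.
Proof.
move=> v00; have u0 : 0 < v0 / 2 by rewrite divr_gt0.
have [C C0 H] := gauss_jet_bounded (n + 2 * r.+1) B u0.
exists C => // y s yB sv.
have vx (x : R) : `|x| <= `|s| -> v0 / 2 <= v0 + 2 * x.
  move=> xs; have : `|x| <= v0 / 4 by exact: le_trans sv.
  by rewrite ler_norml => /andP[h _]; lra.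
have -> : gauss_jet n (v0 + 2 * s) y = gauss_jet (n + 2 * 0) (v0 + 2 * s) y.
  by rewrite muln0 addn0.
rewrite [X in _ - X](_ : _ =
    \sum_(k < r.+1) s ^+ k / k`!%:R * gauss_jet (n + 2 * k) (v0 + 2 * 0) y).
  apply: (@taylor_bound _ r.+1 (fun k s => gauss_jet (n + 2 * k) (v0 + 2 * s) y)).
    move=> k x _ xs.
    have d1 := is_derive_gauss_jet_var (n + 2 * k) y (lt_le_trans u0 (vx x xs)).
    have d2 : is_derive x 1 (fun x => v0 + 2 * x) 2.
      exact: is_derive_affine.
    have := @is_derive1_comp _ (fun v => gauss_jet (n + 2 * k) v y)
      (fun x => v0 + 2 * x) x _ _ d1 d2.
    by rewrite divfK ?pnatr_eq0// mulnS addnCA add2n.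
  by move=> x xs; apply: H => //; exact: vx.
by under [RHS]eq_bigr do rewrite mulr0 addr0.
Qed.

Lemma fact_ratio_le1 (R : realType) (x : R) n : `|x| <= 1 -> `|x ^+ n / n`!%:R| <= 1.
Proof.
move=> x1; rewrite normrM normrX normfV normr_nat.
rewrite ler_pdivrMr ?ltr0n ?fact_gt0// mul1r.
by rewrite (@le_trans _ _ 1) ?exprn_ile1// ler1n fact_gt0.
Qed.

(** Rectangular truncation: all [n1, n2 <= r] are kept. No alternating signs occur, since the shift
    by [- dt] meets the sign in [gauss_jet]. *)
Definition gauss_taylor (R : realType) (r : nat) (v0 dt b y : R) : R :=
  \sum_(n1 < r.+1) \sum_(n2 < r.+1) dt ^+ n1 / n1`!%:R * (b ^+ n2 / n2`!%:R) *
    gauss_jet (n1 + 2 * n2) v0 y.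

(** The location is expanded first, at the perturbed variance, which is why [gauss_shift_taylor] is
    uniform in the variance; each resulting jet is then expanded in the variance. *)
Lemma gauss_taylor_bound (R : realType) r (B v0 : R) : 0 < v0 ->
  exists C d : R, [/\ 0 < C, 0 < d & forall y dt b T, `|y| <= B ->
    0 <= T -> T <= d -> `|dt| <= T -> `|b| <= T ^+ 2 ->
    `|gauss (v0 + 2 * b) (y - dt) - gauss_taylor r v0 dt b y| <= C * T ^+ r.+1].
Proof.
move=> v00; have u0 : 0 < v0 / 2 by rewrite divr_gt0.
have [C C0 H] := gauss_shift_taylor r B u0.
(* One constant for all orders up to [r], accumulated by induction. *)
have [C' C'0 H'] : exists2 C' : R, 0 < C' & forall n y s, (n <= r)%N ->
    `|y| <= B -> `|s| <= v0 / 4 ->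
    `|gauss_jet n (v0 + 2 * s) y -
      \sum_(k < r.+1) s ^+ k / k`!%:R * gauss_jet (n + 2 * k) v0 y|
      <= C' * `|s| ^+ r.+1.
  move: {1}r => m; elim: m => [|m [C1 C10 H1]].
    have [C1 C10 H1] := gauss_jet_var_taylor 0 r B v00.
    by exists C1 => // n y s; rewrite leqn0 => /eqP ->; exact: H1.
  have [C2 C20 H2] := gauss_jet_var_taylor m.+1 r B v00.
  exists (C1 + C2); first exact: addr_gt0.
  move=> n y s; rewrite leq_eqVlt => /orP[/eqP ->|nm] yB sv.
    by rewrite (le_trans (H2 _ _ yB sv))// ler_wpM2r ?exprn_ge0// lerDr ltW.
  by rewrite (le_trans (H1 _ _ _ nm yB sv))// ler_wpM2r ?exprn_ge0// lerDl ltW.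
pose d := Num.min 1 (v0 / 4).
have d0 : 0 < d by rewrite lt_min ltr01 divr_gt0.
exists (C + r.+1%:R * C'), d; split => //; first by rewrite addr_gt0// mulr_gt0.
move=> y dt b T yB T0 Td dtT bT.
have [T1 Tv] : T <= 1 /\ T <= v0 / 4 by move: Td; rewrite le_min => /andP[].
have T2 : T ^+ 2 <= T by rewrite expr2 ler_piMl.
have bv : `|b| <= v0 / 4 by rewrite (le_trans bT)// (le_trans T2).
have b2 : v0 / 2 <= v0 + 2 * b by move: bv; rewrite ler_norml => /andP[h _]; lra.
set S1 := \sum_(k < r.+1) dt ^+ k / k`!%:R * gauss_jet k (v0 + 2 * b) y.
have -> : gauss (v0 + 2 * b) (y - dt) - gauss_taylor r v0 dt b y =
   (gauss (v0 + 2 * b) (y - dt) - S1) + (S1 - gauss_taylor r v0 dt b y) by ring.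
rewrite (le_trans (ler_normD _ _))// [leRHS]mulrDl lerD//.
  rewrite (le_trans (H _ _ _ b2 yB (le_trans dtT T1)))//.
  by rewrite ler_wpM2l ?(ltW C0)// lerXn2r ?nnegrE.
rewrite /S1 /gauss_taylor -sumrB (le_trans (ler_norm_sum _ _ _))//.
have -> : r.+1%:R * C' * T ^+ r.+1 = \sum_(k < r.+1) C' * T ^+ r.+1.
  by rewrite sumr_const card_ord -[RHS]mulr_natl mulrA.
apply: ler_sum => k _.
under eq_bigr do rewrite -mulrA.
rewrite -mulr_sumr -mulrBr normrM -[leRHS]mul1r.
apply: ler_pM => //; first by rewrite fact_ratio_le1// (le_trans dtT).
rewrite (le_trans (H' _ _ _ (ltn_ord k) yB bv))//.
rewrite ler_wpM2l ?(ltW C'0)// lerXn2r ?nnegrE//.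
by rewrite (le_trans bT).
Qed.

Lemma std_cdf_taylor (R : realType) r (B : R) :
  exists2 C : R, 0 < C & forall z w, `|z| <= B -> `|w| <= B ->
    `|std_cdf (z + w) - std_cdf z -
      \sum_(k < r) w ^+ k.+1 / k.+1`!%:R * cdf_jet k.+1 z| <= C * `|w| ^+ r.+1.
Proof.
have [C C0 H] := cdf_jet_bounded r.+1 (B + B).
exists C => // z w zB wB.
have := @taylor_bound R r.+1 (fun k s => cdf_jet k (z + s)) w C.
rewrite big_ord_recl/= expr0 fact0 divr1 mul1r addr0 opprD addrA; apply.
  move=> k x _ _.
  have d1 := is_derive_cdf_jet k (z + x).
  have d2 : is_derive x 1 (fun x => z + x) 1.
    by have := is_derive_affine z 1 x; under eq_fun do rewrite mul1r.
  have := @is_derive1_comp _ (cdf_jet k) (fun x => z + x) x _ _ d1 d2.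
  by rewrite mulr1.
move=> x xw; apply: H.
by rewrite (le_trans (ler_normD _ _))// lerD// (le_trans xw).
Qed.

(** All derivatives of [std_cdf] of positive order are polynomials times [gauss 1]; a change of the
    slanting factor therefore creates no new term with [std_cdf]. *)
Definition cdf_taylor_poly (R : realType) (r : nat) (l0 : R) (w : {poly R}) : {poly R} :=
  \sum_(k < r) ((-1) ^+ k / k.+1`!%:R) *: (w ^+ k.+1 * (herm 1 k \Po (l0 *: 'X))).

Lemma cdf_taylor_polyE (R : realType) (r : nat) (l0 y : R) (w : {poly R}) :
  \sum_(k < r) w.[y] ^+ k.+1 / k.+1`!%:R * cdf_jet k.+1 (l0 * y) =
  (cdf_taylor_poly r l0 w).[y] * gauss 1 (l0 * y).
Proof.
rewrite /cdf_taylor_poly horner_sum mulr_suml; apply: eq_bigr => k _.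
rewrite hornerZ hornerM horner_exp horner_comp hornerZ hornerX /= /gauss_jet.
by ring.
Qed.

Definition gauss_taylor_poly (R : realType) (r : nat) (v0 dt b : R) : {poly R} :=
  \sum_(n1 < r.+1) \sum_(n2 < r.+1)
    (dt ^+ n1 / n1`!%:R * (b ^+ n2 / n2`!%:R)) *: herm v0 (n1 + 2 * n2).

Lemma gauss_taylor_polyE (R : realType) (r : nat) (v0 dt b y : R) :
  gauss_taylor r v0 dt b y = (gauss_taylor_poly r v0 dt b).[y] * gauss v0 y.
Proof.
rewrite /gauss_taylor_poly horner_sum mulr_suml; apply: eq_bigr => n1 _.
rewrite horner_sum mulr_suml; apply: eq_bigr => n2 _.
by rewrite hornerZ /gauss_jet; exact: mulrA.
Qed.

Lemma size_gauss_taylor_poly (R : realType) (r : nat) (v0 dt b : R) : 0 < v0 ->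
  (size (gauss_taylor_poly r v0 dt b) <= (3 * r).+1)%N.
Proof.
move=> v00; rewrite (leq_trans (size_sum _ _ _))//; apply/bigmax_leqP => n1 _.
rewrite (leq_trans (size_sum _ _ _))//; apply/bigmax_leqP => n2 _.
rewrite (leq_trans (size_scale_leq _ _))// size_herm// ltnS.
have := ltn_ord n1; have := ltn_ord n2; rewrite !ltnS; lia.
Qed.

Lemma size_cdf_taylor_poly (R : realType) (r : nat) (l0 : R) (w : {poly R}) :
  (size w <= 2)%N -> (size (cdf_taylor_poly r l0 w) <= (3 * r).+1)%N.
Proof.
move=> w2; rewrite (leq_trans (size_sum _ _ _))//; apply/bigmax_leqP => k _.
rewrite (leq_trans (size_scale_leq _ _))// (leq_trans (size_polyMleq _ _))//.
have h1 : (size (w ^+ k.+1) <= k.+2)%N.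
  rewrite (leq_trans (size_poly_exp_leq _ _))// ltnS -[leqRHS]mul1n leq_mul2r.
  by rewrite -subn1 leq_subLR w2 orbT.
have h2 : (size (herm 1 k \Po (l0 *: 'X)) <= k.+1)%N.
  rewrite (leq_trans (size_comp_poly_leq _ _))// size_herm//= ltnS.
  rewrite -[leqRHS]muln1 leq_mul2l -subn1 leq_subLR.
  by rewrite (leq_trans (size_scale_leq _ _)) ?size_polyX ?orbT.
have := ltn_ord k; move: h1 h2; move: (size (w ^+ _)) (size (_ \Po _)); lia.
Qed.

Definition slant_shift (R : realType) (l0 dt dl : R) : {poly R} :=
  dl *: 'X - ((l0 + dl) * dt)%:P.

Lemma size_slant_shift (R : realType) (l0 dt dl : R) :
  (size (slant_shift l0 dt dl) <= 2)%N.
Proof.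
rewrite (leq_trans (size_polyD _ _))// geq_max size_polyN size_polyC.
rewrite (leq_trans (size_scale_leq _ _)) ?size_polyX//=.
by case: (_ != _).
Qed.

Lemma slant_shiftE (R : realType) (l0 dt dl y : R) :
  (l0 + dl) * (y - dt) = l0 * y + (slant_shift l0 dt dl).[y].
Proof. by rewrite /slant_shift hornerD hornerN hornerC hornerZ hornerX; ring. Qed.

Lemma slant_shift_bound (R : realType) (l0 dt dl y B T : R) :
  `|y| <= B -> 0 <= T -> T <= 1 -> `|dt| <= T -> `|dl| <= T ->
  `|(slant_shift l0 dt dl).[y]| <= (B + `|l0| + 1) * T.
Proof.
move=> yB T0 T1 dtT dlT; rewrite /slant_shift !hornerE.
rewrite (le_trans (ler_normB _ _))// -addrA [leRHS]mulrDl lerD//.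
  by rewrite normrM mulrC ler_pM.
rewrite normrM ler_pM// (le_trans (ler_normD _ _))// lerD//.
exact: le_trans T1.
Qed.

Lemma skew_taylor (R : realType) (r : nat) (B v0 l0 : R) : 0 < v0 -> 0 <= B ->
  exists C d : R, [/\ 0 < C, 0 < d & forall y dt b dl T, `|y| <= B ->
    0 <= T -> T <= d -> `|dt| <= T -> `|b| <= T ^+ 2 -> `|dl| <= T ->
    `|gauss (v0 + 2 * b) (y - dt) * std_cdf ((l0 + dl) * (y - dt)) -
      (gauss_taylor r v0 dt b y * std_cdf (l0 * y) +
       (gauss_taylor_poly r v0 dt b *
        cdf_taylor_poly r l0 (slant_shift l0 dt dl)).[y] *
       (gauss v0 y * gauss 1 (l0 * y)))| <= C * T ^+ r.+1].
Proof.
move=> v00 B0.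
have [C [d [C0 d0 H]]] := gauss_taylor_bound r B v00.
pose W := B + `|l0| + 1.
have W0 : 0 < W by rewrite ltr_wpDl// addr_ge0.
pose B' := `|l0| * B + W.
have [C' C'0 H'] := std_cdf_taylor r B'.
have u0 : 0 < v0 / 2 by rewrite divr_gt0.
have [G G0 HG] := gauss_jet_bounded 0 (B + 1) u0.
pose d' := Num.min d (Num.min 1 (v0 / 4)).
have d'0 : 0 < d' by rewrite !lt_min d0 ltr01 divr_gt0.
exists (C + (G + C) * (C' * W ^+ r.+1)), d'; split => //.
  by rewrite addr_gt0// !mulr_gt0 ?addr_gt0 ?exprn_gt0.
move=> y dt b dl T yB T0 Td dtT bT dlT.
have [Td1 T1 Tv] : [/\ T <= d, T <= 1 & T <= v0 / 4].
  by move: Td; rewrite !le_min => /and3P[].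
set w := slant_shift l0 dt dl.
have wT : `|w.[y]| <= W * T by exact: slant_shift_bound.
rewrite slant_shiftE -/w gauss_taylor_polyE hornerM -gauss_taylor_polyE.
rewrite mulrACA -gauss_taylor_polyE -cdf_taylor_polyE.
have hN := H y dt b T yB T0 Td1 dtT bT.
have wB : `|w.[y]| <= B'.
  rewrite (le_trans wT)// (@le_trans _ _ W)//; first by rewrite ler_piMr// ltW.
  by rewrite lerDr mulr_ge0.
have lB : `|l0 * y| <= B'.
  by rewrite normrM ler_wpDr ?(ltW W0)// ler_wpM2l.
have hF := H' (l0 * y) w.[y] lB wB.
set N := gauss (v0 + 2 * b) (y - dt) in hN *.
set A := gauss_taylor r v0 dt b y in hN *.
set F := std_cdf (l0 * y + w.[y]) in hF *.
set F0 := std_cdf (l0 * y) in hF *.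
set Fc := \sum_(k < r) _ in hF *.
(* The errors of the two factors separate; it remains that [F] is at most one and [A] is bounded. *)
have -> : N * F - (A * F0 + A * Fc) = (N - A) * F + A * (F - F0 - Fc) by ring.
have T2 : T ^+ 2 <= T by rewrite expr2 ler_piMl.
have b2 : v0 / 2 <= v0 + 2 * b.
  have : `|b| <= v0 / 4 by rewrite (le_trans bT)// (le_trans T2).
  by rewrite ler_norml => /andP[h _]; lra.
have NG : `|N| <= G.
  rewrite /N -gauss_jet0 HG// (le_trans (ler_normB _ _))// lerD//.
  exact: le_trans T1.
have AG : `|A| <= G + C.
  have -> : A = N - (N - A) by ring.
  rewrite (le_trans (ler_normB _ _))// lerD// (le_trans hN)//.
  by rewrite ler_piMr ?(ltW C0)// exprn_ile1.
rewrite (le_trans (ler_normD _ _))// [leRHS]mulrDl lerD//.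
  rewrite normrM -[leRHS]mulr1 ler_pM//.
  by rewrite ger0_norm ?std_cdf_ge0// std_cdf_le1.
rewrite normrM -mulrA ler_pM// (le_trans hF)// -mulrA ler_wpM2l ?(ltW C'0)//.
by rewrite -exprMn lerXn2r ?nnegrE ?mulr_ge0// ltW.
Qed.

Lemma herm_bounded (R : realType) (v : R) (n : nat) (B : R) :
  exists2 C : R, 0 < C & forall k y, (k <= n)%N -> `|y| <= B ->
    `|(herm v k).[y]| <= C.
Proof.
elim: n => [|n [C C0 H]].
  by exists 1 => // k y; rewrite leqn0 => /eqP -> _; rewrite hornerC normr1.
have [C' H'] := poly_disk_bound (herm v n.+1) B.
exists (C + `|C'|); first by rewrite ltr_pwDl.
move=> k y; rewrite leq_eqVlt => /orP[/eqP ->|kn] yB.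
  by rewrite (le_trans (H' _ yB))// (le_trans (ler_norm _))// lerDr ltW.
by rewrite (le_trans (H _ _ kn yB))// lerDl.
Qed.

Lemma taylor_weight_le (R : realType) (dt b T : R) n1 n2 m :
  0 <= T -> T <= 1 -> `|dt| <= T -> `|b| <= T ^+ 2 -> (m <= n1 + 2 * n2)%N ->
  `|dt ^+ n1 / n1`!%:R * (b ^+ n2 / n2`!%:R)| <= T ^+ m.
Proof.
move=> T0 T1 dtT bT mn.
rewrite (@le_trans _ _ (T ^+ n1 * (T ^+ 2) ^+ n2))//; last first.
  by rewrite -exprM -exprD ler_wiXn2l.
have f1 k (x : R) : 0 <= x -> x / k`!%:R <= x.
  by move=> x0; rewrite ler_pdivrMr ?ltr0n ?fact_gt0// ler_peMr// ler1n fact_gt0.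
rewrite !normrM !normfV !normr_nat !normrX.
by apply: ler_pM; rewrite ?divr_ge0//; apply: (le_trans (f1 _ _ _));
  rewrite ?exprn_ge0// lerXn2r ?nnegrE// exprn_ge0.
Qed.

(** Counting [b] with weight two, all terms but the two subtracted ones have weight at least two.
    There are at most nine, with [herm] of order at most [6 = 2 + 2 * 2]. *)
Lemma gauss_taylor_poly2_bound (R : realType) (B v0 : R) :
  exists2 C : R, 0 < C & forall y dt b T, `|y| <= B ->
    0 <= T -> T <= 1 -> `|dt| <= T -> `|b| <= T ^+ 2 ->
    `|(gauss_taylor_poly 2 v0 dt b).[y] - (1 + dt / v0 * y)| <= C * T ^+ 2.
Proof.
have [H H0 HH] := herm_bounded v0 6 B.
exists (9 * H); first by rewrite mulr_gt0.
move=> y dt b T yB T0 T1 dtT bT.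
pose c n1 n2 : R := dt ^+ n1 / n1`!%:R * (b ^+ n2 / n2`!%:R).
(* Opaque names for the values of [herm] keep [ring] from unfolding the recursion. *)
have [h hE] : exists h : nat -> R, forall n, (herm v0 n).[y] = h n by eexists.
have h0 : h 0%N = 1 by rewrite -hE hornerC.
have h1 : h 1%N = v0^-1 * y.
  by rewrite -hE (_ : herm v0 1 = v0^-1 *: 'X)// hornerZ hornerX.
have -> : (gauss_taylor_poly 2 v0 dt b).[y] - (1 + dt / v0 * y) =
    \sum_(n1 < 3) \sum_(n2 < 3)
      if (2 <= n1 + 2 * n2)%N then c n1 n2 * h (n1 + 2 * n2)%N else 0.
  rewrite /gauss_taylor_poly horner_sum; under eq_bigr do rewrite horner_sum.
  under eq_bigr do under eq_bigr do rewrite hornerZ hE.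
  rewrite /c !big_ord_recl !big_ord0/=.
  rewrite /bump/= !addr0 !muln0 !addn0 h0 h1.
  rewrite !expr0 !expr1 fact0 !divr1 !mul1r.
  by ring.
rewrite (le_trans (ler_norm_sum _ _ _))//.
have -> : 9 * H * T ^+ 2 = \sum_(n1 < 3) \sum_(n2 < 3) H * T ^+ 2.
  by rewrite !sumr_const !card_ord; ring.
apply: ler_sum => n1 _; rewrite (le_trans (ler_norm_sum _ _ _))//.
apply: ler_sum => n2 _; case: ifP => n12; last first.
  by rewrite normr0 mulr_ge0 ?exprn_ge0// ltW.
rewrite normrM mulrC ler_pM//.
  rewrite -hE; apply: HH => //; have := ltn_ord n1; have := ltn_ord n2; lia.
exact: taylor_weight_le.
Qed.

(** The product of [gauss_taylor_poly 2] and [cdf_taylor_poly 2] up to order three in the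
    increments. The middle term stems from the second derivative of the normal distribution
    function, [- z] times the density. *)
Definition slant_taylor_poly (R : realType) (v0 l0 dt dl : R) : {poly R} :=
  let w := slant_shift l0 dt dl in
  w - (l0 / 2) *: (w ^+ 2 * 'X) + (dt / v0) *: ('X * w).

Lemma size_slant_taylor_poly (R : realType) (v0 l0 dt dl : R) :
  (size (slant_taylor_poly v0 l0 dt dl) <= 4)%N.
Proof.
have w2 := size_slant_shift l0 dt dl.
pose w : {poly R} := slant_shift l0 dt dl.
rewrite -/w in w2.
have wX : (size (w * 'X)%R <= 3)%N.
  by rewrite (leq_trans (size_polyMleq _ _))// size_polyX addn2.
have wwX : (size (w ^+ 2 * 'X)%R <= 4)%N.
  rewrite expr2 -mulrA (leq_trans (size_polyMleq _ _))//.
  by move: w2 wX; move: (size w) (size (w * 'X)); lia.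
rewrite /slant_taylor_poly -/w (leq_trans (size_polyD _ _))// geq_max.
rewrite (leq_trans (size_scale_leq _ _)) ?andbT ?(mulrC 'X); last first.
  exact: leq_trans wX _.
rewrite (leq_trans (size_polyD _ _))// geq_max size_polyN (leq_trans w2)//=.
by rewrite (leq_trans (size_scale_leq _ _)).
Qed.

(** Only [w ^+ 2 * 'X] reaches degree three, since [w] is affine with slope [dl]. Being a square,
    this coefficient cannot cancel between atoms of one group. *)
Lemma coef3_slant_taylor_poly (R : realType) (v0 l0 dt dl : R) :
  (slant_taylor_poly v0 l0 dt dl)`_3 = - (l0 / 2) * dl ^+ 2.
Proof.
rewrite /slant_taylor_poly /slant_shift; set c := (l0 + dl) * dt.
have -> : (dl *: 'X - c%:P) ^+ 2 * 'X =
    (dl ^+ 2) *: 'X^3 - (2 * dl * c) *: 'X^2 + (c ^+ 2) *: 'X :> {poly R}.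
  rewrite -!mul_polyC !polyCM !exprS !expr0; ring.
have -> : 'X * (dl *: 'X - c%:P) = dl *: 'X^2 - c *: 'X :> {poly R}.
  rewrite -!mul_polyC; ring.
rewrite !(coefD, coefN, coefZ, coefXn, coefX, coefC)/=.
by ring.
Qed.

(** The polynomial of the slanting factor is already [O(T)], so the Gaussian factor is needed only
    up to its linear part, with error [O(T ^ 2)]. *)
Lemma skew_taylor_slant (R : realType) (B v0 l0 : R) : 0 < v0 -> 0 <= B ->
  exists C d : R, [/\ 0 < C, 0 < d & forall y dt b dl T, `|y| <= B ->
    0 <= T -> T <= d -> `|dt| <= T -> `|b| <= T ^+ 2 -> `|dl| <= T ->
    `|gauss (v0 + 2 * b) (y - dt) * std_cdf ((l0 + dl) * (y - dt)) -
      (gauss_taylor 2 v0 dt b y * std_cdf (l0 * y) +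
       (slant_taylor_poly v0 l0 dt dl).[y] *
       (gauss v0 y * gauss 1 (l0 * y)))| <= C * T ^+ 3].
Proof.
move=> v00 B0.
have [C [d [C0 d0 H]]] := skew_taylor 2 l0 v00 B0.
have [Ca Ca0 Ha] := gauss_taylor_poly2_bound B v0.
pose W := B + `|l0| + 1.
have W0 : 0 < W by rewrite ltr_wpDl// addr_ge0.
have [G G0 HG] := gauss_jet_bounded 0 B v00.
have [G' G'0 HG'] := gauss_jet_bounded 0 (`|l0| * B) ltr01.
pose K := W + W ^+ 2 * (`|l0| * B).
have K0 : 0 < K by rewrite ltr_pwDl// !mulr_ge0 ?exprn_ge0 ?(ltW W0).
pose K' := v0^-1 * B * (W ^+ 2 * (`|l0| * B)).
have K'0 : 0 <= K' by rewrite !mulr_ge0 ?exprn_ge0 ?(ltW W0) ?invr_ge0 ?(ltW v00).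
exists (C + (Ca * K + K') * (G * G')), (Num.min d 1).
split.
- rewrite ltr_pwDl// mulr_ge0 ?(mulr_ge0 (ltW G0) (ltW G'0))//.
  by rewrite addr_ge0// (mulr_ge0 (ltW Ca0) (ltW K0)).
- by rewrite lt_min d0 ltr01.
move=> y dt b dl T yB T0; rewrite le_min => /andP[Td T1] dtT bT dlT.
set q := slant_taylor_poly _ _ _ _; set NF := _ * std_cdf _.
set A := gauss_taylor _ _ _ _ _; set F0 := std_cdf (l0 * y).
have := H y dt b dl T yB T0 Td dtT bT dlT; rewrite -/NF -/A -/F0.
set p := _ * cdf_taylor_poly _ _ _; set g := gauss v0 y * _ => Hp.
have -> : NF - (A * F0 + q.[y] * g) = NF - (A * F0 + p.[y] * g) + (p.[y] - q.[y]) * g.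
  by ring.
rewrite (le_trans (ler_normD _ _))// [leRHS]mulrDl lerD//.
have gG : `|g| <= G * G'.
  rewrite normrM ler_pM// -gauss_jet0 ?HG ?HG'// normrM ler_wpM2l//.
suff pq : `|p.[y] - q.[y]| <= (Ca * K + K') * T ^+ 3.
  by rewrite normrM mulrAC ler_pM.
have yl : `|l0 * y| <= `|l0| * B by rewrite normrM ler_wpM2l.
pose w := (slant_shift l0 dt dl).[y].
have wT : `|w| <= W * T by exact: slant_shift_bound.
have w2 : `|w ^+ 2 / 2 * (l0 * y)| <= W ^+ 2 * (`|l0| * B) * T ^+ 2.
  rewrite normrM [leRHS]mulrAC ler_pM//.
  rewrite -exprMn normrM normrX normfV normr_nat ler_pdivrMr//.
  rewrite (@le_trans _ _ ((W * T) ^+ 2))//.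
    by rewrite lerXn2r ?nnegrE// mulr_ge0// ltW.
  by rewrite ler_peMr ?exprn_ge0 ?mulr_ge0 ?(ltW W0)// ler1n.
have fE : (cdf_taylor_poly 2 l0 (slant_shift l0 dt dl)).[y] = w - w ^+ 2 / 2 * (l0 * y).
  have [h hE] : exists h : nat -> R, forall k, (herm 1 k).[(l0 *: 'X).[y]] = h k.
    by eexists.
  have h0 : h 0%N = 1 by rewrite -hE hornerC.
  have h1 : h 1%N = l0 * y.
    by rewrite -hE (_ : herm 1 1 = 1^-1 *: 'X)// !hornerZ !hornerX invr1 mul1r.
  rewrite /cdf_taylor_poly horner_sum.
  under eq_bigr do rewrite hornerZ hornerM horner_exp horner_comp -/w hE.
  rewrite !big_ord_recl big_ord0 /bump/= ?addn0 h0 h1 expr0 ?expr1.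
  by rewrite (_ : 1`!%:R = 1)// (_ : 2`!%:R = 2)//; field.
have qE : q.[y] = w - w ^+ 2 / 2 * (l0 * y) + dt / v0 * y * w.
  rewrite /q /slant_taylor_poly /w /=; move: (slant_shift _ _ _) => u.
  by rewrite !(hornerD, hornerN, hornerZ, hornerM, hornerX, horner_exp); ring.
rewrite hornerM fE qE.
set a := (gauss_taylor_poly _ _ _ _).[y].
(* Both terms on the right are of order three: second order times first, then first times second.
   [K] and [K'] are their constants. *)
have -> : a * (w - w ^+ 2 / 2 * (l0 * y)) -
    (w - w ^+ 2 / 2 * (l0 * y) + dt / v0 * y * w) =
    (a - (1 + dt / v0 * y)) * (w - w ^+ 2 / 2 * (l0 * y)) -
    dt / v0 * y * (w ^+ 2 / 2 * (l0 * y)) by ring.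
have T2 : T ^+ 2 <= T by rewrite expr2 ler_piMl.
rewrite (le_trans (ler_normB _ _))// [leRHS]mulrDl lerD//.
  rewrite normrM (_ : Ca * K * T ^+ 3 = Ca * T ^+ 2 * (K * T)); last by ring.
  rewrite ler_pM//; first exact: Ha.
  rewrite (le_trans (ler_normB _ _))// [leRHS]mulrDl lerD//.
  by rewrite (le_trans w2)// ler_wpM2l// !mulr_ge0 ?exprn_ge0 ?(ltW W0).
rewrite normrM (_ : K' * T ^+ 3 = v0^-1 * B * T * (W ^+ 2 * (`|l0| * B) * T ^+ 2)).
  rewrite ler_pM// !normrM mulrAC normfV (gtr0_norm v00) mulrC.
  by rewrite -mulrA (mulrC B) ler_wpM2l ?invr_ge0 ?(ltW v00)// ler_pM.
by rewrite /K'; ring.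
Qed.

(** * The polynomial system *)

(* For [n <= r], the coefficient of [t ^+ n] in [exp (a * t + b * t ^+ 2)]. *)
Definition heat_coef (R : realType) (r n : nat) (a b : R) : R :=
  \sum_(n1 < r.+1) \sum_(n2 < r.+1)
    if (n1 + 2 * n2 == n)%N then a ^+ n1 / n1`!%:R * (b ^+ n2 / n2`!%:R) else 0.

Lemma heat_coef_widen (R : realType) (r n : nat) (a b : R) : (n <= r)%N ->
  heat_coef r n a b = heat_coef n n a b.
Proof.
move=> nr; rewrite /heat_coef.
rewrite [RHS](big_ord_widen r.+1 (fun n1 => \sum_(n2 < n.+1)
  if (n1 + 2 * n2 == n)%N then a ^+ n1 / n1`!%:R * (b ^+ n2 / n2`!%:R) else 0))//.
rewrite [RHS]big_mkcond/=; apply: eq_bigr => n1 _.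
case: ifPn => h; last first.
  by apply: big1 => n2 _; case: ifPn => // /eqP e; exfalso; move: h; lia.
rewrite [RHS](big_ord_widen r.+1 (fun n2 =>
  if (n1 + 2 * n2 == n)%N then a ^+ n1 / n1`!%:R * (b ^+ n2 / n2`!%:R) else 0))//.
rewrite [RHS]big_mkcond/=; apply: eq_bigr => n2 _.
by case: ifPn => // /eqP e; case: ifPn => // h'; exfalso; move: h'; lia.
Qed.

(** Quasi-homogeneity with weights one and two, the reason why a compact set of normalised
    increments suffices. *)
Lemma heat_coef_scale (R : realType) (r n : nat) (T a b : R) :
  heat_coef r n (T * a) (T ^+ 2 * b) = T ^+ n * heat_coef r n a b.
Proof.
rewrite /heat_coef mulr_sumr; apply: eq_bigr => n1 _.
rewrite mulr_sumr; apply: eq_bigr => n2 _.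
case: eqP => [<-|_]; last by rewrite mulr0.
rewrite exprD (exprM T 2); move: (T ^+ 2) => S.
by rewrite !exprMn; ring.
Qed.

(** The heat equation makes the jet depend on [n1 + 2 * n2] alone, at most [3 * r]. Above order [r]
    the rectangular truncation may drop terms; only orders up to [r] are read off later. *)
Lemma gauss_taylorE (R : realType) (r : nat) (v0 dt b y : R) :
  gauss_taylor r v0 dt b y =
  \sum_(n < (3 * r).+1) heat_coef r n dt b * gauss_jet n v0 y.
Proof.
rewrite /gauss_taylor /heat_coef.
under [RHS]eq_bigr do rewrite mulr_suml.
rewrite [RHS]exchange_big/=; apply: eq_bigr => n1 _.
under [RHS]eq_bigr do rewrite mulr_suml.
rewrite [RHS]exchange_big/=; apply: eq_bigr => n2 _.
have h : (n1 + 2 * n2 < (3 * r).+1)%N.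
  by have := ltn_ord n1; have := ltn_ord n2; lia.
rewrite (bigD1 (Ordinal h))//= eqxx big1 ?addr0// => i /eqP ih.
case: ifPn => [/eqP e|]; rewrite ?mul0r//.
by exfalso; apply: ih; apply: val_inj; rewrite /= e.
Qed.

Lemma heat_coef00 (R : realType) (n : nat) : (0 < n)%N -> heat_coef n n (0 : R) 0 = 0.
Proof.
move=> n0; apply: big1 => n1 _; apply: big1 => n2 _; case: ifPn => // /eqP e.
have [n10|n10] := posnP n1; last by rewrite expr0n gtn_eqF// mul0r mul0r.
by rewrite [0 ^+ n2]expr0n gtn_eqF ?mul0r ?mulr0//; lia.
Qed.

Lemma heat_coef_small (R : realType) (a b : R) :
  [/\ heat_coef 1 1 a b = a, heat_coef 2 2 a b = a ^+ 2 / 2 + b &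
      heat_coef 3 3 a b = a ^+ 3 / 6 + a * b].
Proof.
split; rewrite /heat_coef !big_ord_recl !big_ord0/= /bump/= ?addr0 ?add0r
  ?expr0 ?expr1 ?fact0 ?divr1 ?mul1r ?mulr1//.
- by rewrite addrC.
- by rewrite addrC.
Qed.

Lemma heat_coef40 (R : realType) (b : R) : heat_coef 4 4 0 b = b ^+ 2 / 2.
Proof.
rewrite /heat_coef !big_ord_recl !big_ord0/= /bump/= ?addr0 ?add0r.
by rewrite expr0 !fact0 !expr0n/= !mul0r !addr0 divr1 mul1r.
Qed.

Lemma solves_systemE (R : realType) (N r : nat) (c a b : 'I_N -> R) :
  solves_system r c a b <->
  (forall n, (1 <= n <= r)%N -> \sum_j c j ^+ 2 * heat_coef n n (a j) (b j) = 0).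
Proof.
have E n : \sum_(j < N) \sum_(n1 < n.+1) \sum_(n2 < n.+1 | (n1 + 2 * n2 == n)%N)
        c j ^+ 2 * a j ^+ n1 * b j ^+ n2 / (n1`! * n2`!)%:R =
     \sum_j c j ^+ 2 * heat_coef n n (a j) (b j).
  apply: eq_bigr => j _; rewrite /heat_coef mulr_sumr; apply: eq_bigr => n1 _.
  rewrite mulr_sumr big_mkcond/=; apply: eq_bigr => n2 _.
  case: ifP => _; last by rewrite mulr0.
  by rewrite natrM invfM; ring.
by split=> h n nr; [rewrite -E|rewrite E]; exact: h.
Qed.

(** Witness: [exp (t - t ^ 2 / 2) + exp (- t - t ^ 2 / 2) = 2 + O(t ^ 4)]; the remaining unknowns
    sit at zero and contribute nothing. Consequently [rbar] is at least four. *)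
Lemma has_nontrivial_solution_le3 (R : realType) (N r : nat) :
  (2 <= N)%N -> (r <= 3)%N -> has_nontrivial_solution R N r.
Proof.
move=> N2 r3.
pose a (j : 'I_N) : R := if val j == 0%N then 1 else if val j == 1%N then -1 else 0.
pose b (j : 'I_N) : R := if (val j < 2)%N then - 2^-1 else 0.
pose j0 : 'I_N := Ordinal (ltnW N2); pose j1 : 'I_N := Ordinal N2.
exists (fun => 1), a, b; split.
- by move=> j; exact: oner_neq0.
- by exists j0; rewrite /a/= oner_neq0.
apply/solves_systemE => n /andP[n1 nr].
rewrite (bigD1 j0)//= (bigD1 j1)//= big1 ?addr0; last first.
  move=> j /andP[jj0 jj1].
  have jn : (1 < j)%N.
    move: jj0 jj1; rewrite -!val_eqE/=; case: (nat_of_ord j) => [|[|]]//.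
  rewrite /a /b ltnNge jn/= !gtn_eqF ?(ltnW jn)//.
  by rewrite heat_coef00 ?mulr0.
rewrite expr1n !mul1r /a /b/=.
have {nr} : (n <= 3)%N by exact: leq_trans r3.
have [h1 h2 h3] := heat_coef_small (1 : R) (- 2^-1).
have [h1' h2' h3'] := heat_coef_small (-1 : R) (- 2^-1).
by case: n n1 => [|[|[|[|]]]]// _ _; rewrite ?h1 ?h2 ?h3 ?h1' ?h2' ?h3'; field.
Qed.

Lemma continuous_heat_coef (R : realType) (T : topologicalType) (n : nat)
    (a b : T -> R) : continuous a -> continuous b ->
  continuous (fun x => heat_coef n n (a x) (b x)).
Proof.
move=> ca cb.
have cX k (f : T -> R) : continuous f -> continuous (fun x => f x ^+ k / k`!%:R).
  move=> cf x; apply: cvgM; last exact: cvg_cst.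
  exact: (continuous_comp (cf x) (@exprn_continuous R k (f x))).
apply: continuous_big => [|n1 _]; first exact: add_continuous.
apply: continuous_big => [|n2 _]; first exact: add_continuous.
case: (n1 + 2 * n2 == n)%N => x; last exact: cvg_cst.
by apply: cvgM; [exact: cX|exact: cX].
Qed.

(** The sum of the absolute values of the left-hand sides is continuous and, by unsolvability,
    positive on a compact set, hence bounded below there. Weights play the part of [c_j ^ 2]; the
    upper bound [c0 + 1] leaves room both for weights up to one and for the value [c0] used as
    padding. *)
Lemma heat_system_bound (R : realType) (N r : nat) (c0 : R) :
  (2 <= N)%N -> is_rbar R N r -> 0 < c0 ->
  exists2 c : R, 0 < c & forall p a b : 'I_N -> R,
    (forall j, c0 <= p j <= c0 + 1) ->
    (forall j, `|a j| <= 1) -> (forall j, `|b j| <= 1) ->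
    (exists j, Num.max `|a j| `|b j| = 1) ->
    exists2 n, (1 <= n <= r)%N & c <= `|\sum_j p j * heat_coef n n (a j) (b j)|.
Proof.
move=> N2 [r1 nosol rmin] c00.
have r4 : (4 <= r)%N.
  by rewrite ltnNge; apply/negP => r3; apply: nosol; exact: has_nontrivial_solution_le3.
pose T := ('rV[R]_N * ('rV[R]_N * 'rV[R]_N))%type.
pose pp (v : T) (j : 'I_N) : R := v.1 ord0 j.
pose aa (v : T) (j : 'I_N) : R := v.2.1 ord0 j.
pose bb (v : T) (j : 'I_N) : R := v.2.2 ord0 j.
have cfst (U V : topologicalType) : continuous (fun x : U * V => x.1).
  by move=> x; exact: cvg_fst.
have csnd (U V : topologicalType) : continuous (fun x : U * V => x.2).
  by move=> x; exact: cvg_snd.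
have ccomp (U V W : topologicalType) (f : U -> V) (g : V -> W) :
    continuous f -> continuous g -> continuous (g \o f).
  by move=> cf cg x; apply: continuous_comp; [exact: cf|exact: cg].
have ccoord j : continuous (fun w : 'rV[R]_N => w ord0 j : R) by exact: coord_continuous.
have cpp j : continuous (fun v => pp v j) := ccomp _ _ _ _ _ (cfst _ _) (ccoord j).
have caa j : continuous (fun v => aa v j) :=
  ccomp _ _ _ _ _ (ccomp _ _ _ _ _ (csnd _ _) (cfst _ _)) (ccoord j).
have cbb j : continuous (fun v => bb v j) :=
  ccomp _ _ _ _ _ (ccomp _ _ _ _ _ (csnd _ _) (csnd _ _)) (ccoord j).
have cabs (f : T -> R) : continuous f -> continuous (fun v => `|f v|).
  by move=> cf; apply: (ccomp _ _ _ f (fun z : R => `|z|)) => //; exact: norm_continuous.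
pose E n v := \sum_j pp v j * heat_coef n n (aa v j) (bb v j).
pose Psi v := \sum_(n < r) `|E n.+1 v|.
have cPsi : continuous Psi.
  apply: continuous_big => [|n _]; first exact: add_continuous.
  apply: cabs; apply: continuous_big => [|j _]; first exact: add_continuous.
  by move=> v; apply: cvgM; [exact: cpp|exact: continuous_heat_coef].
pose box (x y : R) := [set w : 'rV[R]_N | forall i, `[x, y]%classic (w ord0 i)].
have cbox x y : compact (box x y).
  exact: (@rV_compact _ N (fun=> `[x, y]%classic) (fun=> @segment_compact R x y)).
(* One compact set for each index at which the maximum is one. *)
pose S j0 := (box c0 (c0 + 1) `*` (box (-1) 1 `*` box (-1) 1)) `&`
  [set v : T | Num.max `|aa v j0| `|bb v j0| = 1].
have cS j0 : compact (S j0).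
  apply: compact_closedI; first by do 2 (apply: compact_setX => //).
  have : closed [set x : R | x = 1] by exact: closed_eq.
  apply: preimage_closed => v _.
  exact: (@continuous_max _ _ (fun v => `|aa v j0|) (fun v => `|bb v j0|) v
    (cabs _ (caa j0) v) (cabs _ (cbb j0) v)).
have Psi_gt0 j0 v : S j0 v -> 0 < Psi v.
  move=> [[vp [va vb]] vmax].
  have p0 j : 0 < pp v j.
    by have := vp j; rewrite /= in_itv/= => /andP[h _]; exact: lt_le_trans h.
  rewrite lt_neqAle sumr_ge0// andbT eq_sym; apply/negP => /eqP P0.
  have E0 n : (1 <= n <= r)%N -> E n v = 0.
    case: n => // n /andP[_ nr]; apply/eqP; rewrite -normr_eq0; apply/eqP.
    have := P0; rewrite /Psi (bigD1 (Ordinal nr))//= => /eqP.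
    by rewrite paddr_eq0 ?sumr_ge0// => /andP[/eqP].
  have sq j : Num.sqrt (pp v j) ^+ 2 = pp v j by rewrite sqr_sqrtr// ltW.
  have a0 j : aa v j = 0.
    apply: contrapT => /eqP aj; apply: nosol.
    exists (fun j => Num.sqrt (pp v j)), (aa v), (bb v); split.
    - by move=> j'; rewrite gt_eqF// sqrtr_gt0.
    - by exists j.
    - apply/solves_systemE => n nr; rewrite -[RHS](E0 n nr).
      by apply: eq_bigr => i _; rewrite sq.
  (* Non-triviality constrains the [a_j] only. Once they all vanish, the equation of order four is a
     sum of non-negative terms [p_j * b_j ^ 2 / 2], which forces the [b_j] to vanish too; here
     [r >= 4] is used. *)
  have b0 : bb v j0 = 0.
    have := E0 4%N r4; rewrite /E.
    under eq_bigr do rewrite a0 heat_coef40.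
    move=> /eqP; rewrite psumr_eq0; last first.
      by move=> j _; rewrite mulr_ge0 ?(ltW (p0 _))// divr_ge0 ?sqr_ge0.
    move=> /allP /(_ j0 (mem_index_enum _)) /=.
    by rewrite !mulf_eq0 (gt_eqF (p0 _))/= invr_eq0 pnatr_eq0 orbF orbb => /eqP.
  by have := vmax; rewrite /= a0 b0 normr0 maxxx => /eqP; rewrite eq_sym oner_eq0.
have minS j0 : exists2 c : R, 0 < c & forall v, S j0 v -> c <= Psi v.
  have [[w Sw]|noS] := pselect (S j0 !=set0); last first.
    by exists 1 => // v Sv; exfalso; apply: noS; exists v.
  have [v Sv vmin] := compact_EVT_min (ex_intro _ w Sw) (cS j0)
    (continuous_subspaceT cPsi).
  exists (Psi v); first by apply: (Psi_gt0 j0); exact: set_mem Sv.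
  by move=> u Su; apply: vmin; exact: mem_set.
have [c cP] := choice (fun j => match minS j with ex_intro2 c h1 h2 => ex_intro _ c (conj h1 h2) end).
pose m := \big[Num.min/1]_j c j.
have m0 : 0 < m.
  rewrite /m; elim/big_ind: _ => // [x y x0 y0|j _]; first by rewrite lt_min x0.
  by have [] := cP j.
have mc j : m <= c j by rewrite /m (bigD1 j)//= ge_min lexx.
exists (m / r%:R); first by rewrite divr_gt0// ltr0n.
move=> p a b pc a1 b1 [j0 jmax].
pose v : T := (\row_j p j, (\row_j a j, \row_j b j)).
have Sv : S j0 v.
  split; last by rewrite /= /aa /bb !mxE.
  split; first by move=> i; rewrite /= mxE in_itv/=; exact: pc.
  by split=> i; rewrite /= mxE in_itv/= -ler_norml.
have mP : m <= Psi v by rewrite (le_trans (mc j0))//; have [_] := cP j0; exact.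
apply: contrapT => none.
suff : Psi v < m by rewrite ltNge mP.
rewrite (@lt_le_trans _ _ (\sum_(n < r) m / r%:R))//; last first.
  by rewrite sumr_const card_ord -[leLHS]mulr_natr divfK// pnatr_eq0 -lt0n.
apply: ltr_sum => [|n _]; first by apply/hasP; exists (Ordinal r1); rewrite ?mem_index_enum.
rewrite ltNge; apply/negP => h; apply: none; exists n.+1; first exact: ltn_ord.
rewrite (le_trans h)// /E /pp /aa /bb/=.
by under eq_bigr do rewrite !mxE.
Qed.

(** Rescaling by [T] normalises the increments. A group with fewer than [N] members is padded with
    weight [c0] and zero increments, which do not contribute to any order [n > 0]. *)
Lemma heat_group_bound (R : realType) (N r : nat) (c0 : R) :
  (2 <= N)%N -> is_rbar R N r -> 0 < c0 -> c0 <= 1 ->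
  exists2 c : R, 0 < c & forall (J : finType) (A : {set J}) (p dt b : J -> R) (T : R),
    (#|A| <= N)%N -> 0 < T ->
    (forall j, j \in A -> c0 <= p j <= 1) ->
    (forall j, j \in A -> `|dt j| <= T) ->
    (forall j, j \in A -> `|b j| <= T ^+ 2) ->
    (exists2 j, j \in A & `|dt j| = T \/ `|b j| = T ^+ 2) ->
    exists2 n, (1 <= n <= r)%N &
      c * T ^+ n <= `|\sum_(j in A) p j * heat_coef n n (dt j) (b j)|.
Proof.
move=> N2 rP c00 c01; have [c c_gt0 H] := heat_system_bound N2 rP c00.
exists c => // J A p dt b T AN T0 pc dtT bT [j0 j0A j0T].
have T20 : 0 < T ^+ 2 by rewrite exprn_gt0.
pose e (i : nat) := nth j0 (enum A) i.
have eA (i : nat) : (i < #|A|)%N -> e i \in A.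
  by move=> iA; rewrite -mem_enum mem_nth// -cardE.
pose p' (i : 'I_N) := if (i < #|A|)%N then p (e i) else c0.
pose a' (i : 'I_N) := if (i < #|A|)%N then T^-1 * dt (e i) else 0.
pose b' (i : 'I_N) := if (i < #|A|)%N then (T ^+ 2)^-1 * b (e i) else 0.
have sumE n : (0 < n)%N -> \sum_i p' i * heat_coef n n (a' i) (b' i) =
    (T ^+ n)^-1 * \sum_(j in A) p j * heat_coef n n (dt j) (b j).
  move=> n0.
  have -> : \sum_(j in A) p j * heat_coef n n (dt j) (b j) =
      \sum_(i < #|A|) p (e i) * heat_coef n n (dt (e i)) (b (e i)).
    by rewrite -[LHS]big_enum (big_nth j0) big_mkord cardE.
  rewrite (big_ord_widen N (fun i => p (e i) * heat_coef n n (dt (e i)) (b (e i))))//.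
  rewrite mulr_sumr [RHS]big_mkcond/=; apply: eq_bigr => i _; rewrite /p' /a' /b'.
  case: ifP => _; last by rewrite heat_coef00// mulr0.
  rewrite -!exprVn heat_coef_scale.
  by rewrite mulrCA.
have [|||| n n1r nP] := H p' a' b'.
- move=> i; rewrite /p'; case: ifP => [iA|_]; last by rewrite lexx lerDl ler01.
  have /andP[-> /= h] := pc _ (eA _ iA).
  by rewrite (le_trans h)// lerDr ltW.
- move=> i; rewrite /a'; case: ifP => [iA|_]; last by rewrite normr0.
  by rewrite normrM normfV (gtr0_norm T0) mulrC ler_pdivrMr// mul1r dtT// eA.
- move=> i; rewrite /b'; case: ifP => [iA|_]; last by rewrite normr0.
  by rewrite normrM normfV (gtr0_norm T20) mulrC ler_pdivrMr// mul1r bT// eA.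
- have iA : (index j0 (enum A) < #|A|)%N by rewrite cardE index_mem mem_enum.
  have ej0 : e (index j0 (enum A)) = j0 by rewrite /e nth_index// mem_enum.
  exists (Ordinal (leq_trans iA AN)); rewrite /a' /b'/= iA ej0.
  rewrite !normrM !normfV (gtr0_norm T0) (gtr0_norm T20).
  have h1 : T^-1 * `|dt j0| <= 1 by rewrite mulrC ler_pdivrMr// mul1r dtT.
  have h2 : (T ^+ 2)^-1 * `|b j0| <= 1 by rewrite mulrC ler_pdivrMr// mul1r bT.
  case: j0T => jT.
    by move: h2; rewrite jT mulVf ?gt_eqF// => h2; apply/max_idPl.
  by move: h1; rewrite jT mulVf ?gt_eqF// => h1; apply/max_idPr.
exists n => //; move: nP; have n0 : (0 < n)%N by case/andP: n1r.
by rewrite sumE// normrM normfV (gtr0_norm (exprn_gt0 _ T0)) mulrC ler_pdivlMr ?exprn_gt0.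
Qed.

(** * Wasserstein distance *)

Lemma param_dist_ge0 (R : realType) (e e' : skew_param R) : 0 <= param_dist e e'.
Proof. by rewrite addr_ge0 ?sqrtr_ge0. Qed.

Definition transport_cost (R : realType) (r : nat) (G G' : mixing R)
    (q : 'M[R]_(natoms G, natoms G')) : R :=
  \sum_i \sum_j q i j * param_dist (atom G i) (atom G' j) ^+ r.

Lemma transport_cost_ge0 (R : realType) (r : nat) (G G' : mixing R) q :
  coupling G G' q -> 0 <= transport_cost r q.
Proof.
move=> [q0 _ _]; do 2 (apply: sumr_ge0 => ? _).
by rewrite mulr_ge0// exprn_ge0// param_dist_ge0.
Qed.

Lemma transport_cost_lbound (R : realType) (r : nat) (G G' : mixing R) :
  lbound [set transport_cost r q | q in coupling G G'] 0.
Proof. by move=> _ [q qc <-]; exact: transport_cost_ge0. Qed.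

Lemma coupling_neq0 (R : realType) (G G' : mixing R) : coupling G G' !=set0.
Proof.
exists (\matrix_(i, j) (weight G i * weight G' j)); split.
- by move=> i j; rewrite mxE mulr_ge0// ltW// weight_gt0.
- move=> i; under eq_bigr do rewrite mxE.
  by rewrite -mulr_sumr weight_sum1 mulr1.
- move=> j; under eq_bigr do rewrite mxE.
  by rewrite -mulr_suml weight_sum1 mul1r.
Qed.

Lemma wasserstein_exp (R : realType) (r : nat) (G G' : mixing R) : (0 < r)%N ->
  wasserstein r G G' ^+ r = inf [set transport_cost r q | q in coupling G G'].
Proof.
move=> r0; rewrite /wasserstein -powR_mulrn ?powR_ge0// -powRrM mulVf; last first.
  by rewrite pnatr_eq0 -lt0n.
rewrite powRr1//; apply: lb_le_inf; last exact: transport_cost_lbound.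
by have [q qc] := coupling_neq0 G G'; exists (transport_cost r q); exists q.
Qed.

Lemma wasserstein_exp_le (R : realType) (r : nat) (G G' : mixing R) q : (0 < r)%N ->
  coupling G G' q -> wasserstein r G G' ^+ r <= transport_cost r q.
Proof.
move=> r0 qc; rewrite wasserstein_exp//; apply: ge_inf; last by exists q.
by exists 0; exact: transport_cost_lbound.
Qed.

(* Each atom of [G'] receives as much as possible from the atoms of [G] assigned
   to it, and the remaining mass is spread by a product coupling. *)
Lemma wasserstein_exp_le_assignment (R : realType) (r : nat) (G G' : mixing R)
    (g : 'I_(natoms G) -> 'I_(natoms G')) (D : R) :
  (0 < r)%N -> (forall i j, param_dist (atom G i) (atom G' j) <= D) ->
  wasserstein r G G' ^+ r <=
    \sum_i weight G i * param_dist (atom G i) (atom G' (g i)) ^+ r +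
    D ^+ r * \sum_j `|\sum_(i | g i == j) weight G i - weight G' j|.
Proof.
move=> r0 dD.
pose P j := \sum_(i | g i == j) weight G i.
pose m j := Num.min (P j) (weight G' j).
(* The proportion of the group's mass kept at [j]; for an empty group it is [0 / 0 = 0]. *)
pose ka j := m j / P j.
pose u i := weight G i * (1 - ka (g i)).
pose v j := weight G' j - m j.
pose L := \sum_j v j.
have w0 i : 0 < weight G i := weight_gt0 i.
have w'0 i : 0 < weight G' i := weight_gt0 i.
have P0 j : 0 <= P j by apply: sumr_ge0 => i _; exact: ltW.
have m0 j : 0 <= m j by rewrite le_min P0 ltW.
have mP j : ka j * P j = m j.
  rewrite /ka; have [Pj|Pj] := eqVneq (P j) 0; last by rewrite divfK.
  by rewrite Pj mulr0 /m Pj; apply/esym/min_idPl; exact: ltW.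
have ka0 j : 0 <= ka j by rewrite divr_ge0.
have ka1 j : ka j <= 1.
  have [Pj|Pj] := eqVneq (P j) 0; first by rewrite /ka Pj invr0 mulr0.
  by rewrite ler_pdivrMr ?mul1r ?lt_neqAle ?P0 ?andbT 1?eq_sym// /m ge_min lexx.
have u0 i : 0 <= u i by rewrite mulr_ge0 ?subr_ge0// ltW.
have v0 j : 0 <= v j by rewrite subr_ge0 /m ge_min lexx orbT.
have uL : \sum_i u i = L.
  rewrite /L /v sumrB weight_sum1 /u.
  under eq_bigr do rewrite mulrBr mulr1.
  rewrite sumrB weight_sum1; congr (_ - _).
  rewrite (partition_big g xpredT)//=; apply: eq_bigr => j _.
  by rewrite -mP /P mulr_sumr; apply: eq_bigr => i /eqP <-; rewrite mulrC.
have L0 : 0 <= L by exact: sumr_ge0.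
(* When no mass remains, [L = 0] and division by it gives zero; all [u i] and [v j] then vanish, so
   the marginals are still correct. *)
have uLL i : u i * (L / L) = u i.
  have [Lz|Ln] := eqVneq L 0; last by rewrite divff// mulr1.
  rewrite Lz mul0r mulr0; move: Lz; rewrite -uL => /eqP.
  by rewrite psumr_eq0// => /allP /(_ i (mem_index_enum _)) /= /eqP ->.
have vLL j : L / L * v j = v j.
  have [Lz|Ln] := eqVneq L 0; last by rewrite divff// mul1r.
  rewrite Lz !mul0r; move: Lz => /eqP.
  by rewrite psumr_eq0// => /allP /(_ j (mem_index_enum _)) /= /eqP ->.
pose q : 'M[R]_(natoms G, natoms G') :=
  \matrix_(i, j) ((if g i == j then weight G i * ka j else 0) + u i * v j / L).
have qc : coupling G G' q.
  split.
  - move=> i j; rewrite mxE addr_ge0//.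
      by case: ifP => // _; rewrite mulr_ge0// ltW.
    by rewrite divr_ge0// mulr_ge0.
  - move=> i; under eq_bigr do rewrite mxE.
    rewrite big_split/= -big_mkcond/= (big_pred1 (g i)); last first.
      by move=> j; rewrite eq_sym.
    rewrite -mulr_suml -mulr_sumr -/L.
    by rewrite -mulrA uLL /u; ring.
  - move=> j; under eq_bigr do rewrite mxE.
    rewrite big_split/= -big_mkcond/= -mulr_suml -/(P j) mulrC mP.
    rewrite -mulr_suml -mulr_suml uL mulrAC vLL /v; ring.
apply: le_trans (wasserstein_exp_le r0 qc) _.
rewrite /transport_cost.
have -> : \sum_i \sum_j q i j * param_dist (atom G i) (atom G' j) ^+ r =
  \sum_i weight G i * ka (g i) * param_dist (atom G i) (atom G' (g i)) ^+ r +
  \sum_i \sum_j u i * v j / L * param_dist (atom G i) (atom G' j) ^+ r.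
  rewrite -big_split/=; apply: eq_bigr => i _.
  under eq_bigr do rewrite mxE mulrDl.
  rewrite big_split/=; congr (_ + _).
  rewrite (bigD1 (g i))//= eqxx big1 ?addr0// => j /negbTE h.
  by rewrite eq_sym h mul0r.
apply: lerD.
  apply: ler_sum => i _; rewrite ler_wpM2r ?exprn_ge0 ?param_dist_ge0//.
  by rewrite ler_piMr// ltW.
apply: (@le_trans _ _ (\sum_i \sum_j u i * v j / L * D ^+ r)).
  apply: ler_sum => i _; apply: ler_sum => j _.
  rewrite ler_wpM2l//; first by rewrite divr_ge0// mulr_ge0.
  by rewrite lerXn2r ?nnegrE ?param_dist_ge0// (le_trans (param_dist_ge0 _ _) (dD i j)).
have -> : \sum_i \sum_j u i * v j / L * D ^+ r = D ^+ r * L.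
  under eq_bigr do rewrite -mulr_suml -mulr_suml -mulr_sumr -/L -[u _ * L / L]mulrA uLL.
  by rewrite -mulr_suml uL mulrC.
have [i _|noG] := pickP (fun i : 'I_(natoms G) => true); last first.
  have : \sum_i weight G i = 0 by apply: big1 => i; have := noG i.
  by move=> /eqP; rewrite weight_sum1 oner_eq0.
have D0 : 0 <= D := le_trans (param_dist_ge0 _ _) (dD i (g i)).
rewrite ler_wpM2l ?exprn_ge0//; apply: ler_sum => j _.
rewrite /v /m distrC; have [h|h] := leP (P j) (weight G' j).
  exact: ler_norm.
by rewrite subrr.
Qed.

(** An atom farther than [rho] from every atom of the other measure sends or receives mass at least
    [mu] over that distance, at cost at least [mu * rho ^+ r]. The bound on its mass is [c0] for [G]
    and the least of finitely many weights for [G']. *)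
Lemma wasserstein_close (R : realType) (r : nat) (G' : mixing R) (c0 rho : R) :
  (0 < r)%N -> 0 < c0 -> 0 < rho ->
  exists2 eps : R, 0 < eps & forall G : mixing R,
    (forall i, c0 <= weight G i) -> wasserstein r G G' <= eps ->
    (forall i, exists j, param_dist (atom G i) (atom G' j) <= rho) /\
    (forall j, exists i, param_dist (atom G i) (atom G' j) <= rho).
Proof.
move=> r0 c00 rho0.
pose mu := Num.min c0 (\big[Num.min/1]_j weight G' j).
have mu0 : 0 < mu.
  rewrite lt_min c00/=; elim/big_ind: _ => // [x y x0 y0|j _].
    by rewrite lt_min x0.
  exact: weight_gt0.
have muc : mu <= c0 by rewrite ge_min lexx.
have muw j : mu <= weight G' j by rewrite ge_min (bigD1 j)//= ge_min lexx orbT.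
pose e := mu * rho ^+ r / 2.
have e0 : 0 < e by rewrite divr_gt0// mulr_gt0// exprn_gt0.
exists (Num.min 1 e); first by rewrite lt_min ltr01.
move=> G wc0; rewrite le_min => /andP[W1 We].
have W0 : 0 <= wasserstein r G G' by exact: powR_ge0.
have We' : wasserstein r G G' ^+ r <= e.
  apply: le_trans We; rewrite -[leRHS]expr1; exact: ler_wiXn2l.
(* A coupling within [e] of the infimum costs less than [2 * e = mu * rho ^+ r], whence the factor
   one half in [e]. *)
have [|_ [q qc <-] qlt] := @inf_adherent _ [set transport_cost r q | q in coupling G G'] e e0.
  split; last by exists 0; exact: transport_cost_lbound.
  by have [q qc] := coupling_neq0 G G'; exists (transport_cost r q); exists q.
rewrite -wasserstein_exp// in qlt.
have {}qlt : transport_cost r q < mu * rho ^+ r.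
  apply: lt_le_trans qlt _; rewrite (le_trans (lerD We' (lexx _)))// /e.
  by rewrite -splitr.
have [q0 qr qcol] := qc.
have t0 i j : 0 <= q i j * param_dist (atom G i) (atom G' j) ^+ r.
  by rewrite mulr_ge0// exprn_ge0// param_dist_ge0.
split=> [i|j]; apply: contrapT => /forallNP far; move: qlt; apply/negP; rewrite -leNgt.
  rewrite /transport_cost (bigD1 i)//= ler_wpDr//.
    by apply: sumr_ge0 => ? _; exact: sumr_ge0.
  apply: (@le_trans _ _ (\sum_j q i j * rho ^+ r)).
    rewrite -mulr_suml qr ler_wpM2r ?exprn_ge0 ?(ltW rho0)//.
    exact: le_trans (wc0 i).
  apply: ler_sum => j _; rewrite ler_wpM2l//.
  have /negP := far j; rewrite -ltNge => h.
  by rewrite lerXn2r ?nnegrE ?param_dist_ge0 ?ltW.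
rewrite /transport_cost exchange_big/= (bigD1 j)//= ler_wpDr//.
  by apply: sumr_ge0 => ? _; exact: sumr_ge0.
apply: (@le_trans _ _ (\sum_i q i j * rho ^+ r)).
  by rewrite -mulr_suml qcol ler_wpM2r ?exprn_ge0 ?(ltW rho0).
apply: ler_sum => i _; rewrite ler_wpM2l//.
have /negP := far i; rewrite -ltNge => h.
by rewrite lerXn2r ?nnegrE ?param_dist_ge0 ?ltW.
Qed.

(** * Functionals of a mixture *)

Lemma continuous_is_derive (R : realType) (f df : R -> R) :
  (forall x : R, is_derive x 1 f (df x)) -> continuous f.
Proof.
move=> d x; apply: differentiable_continuous; apply/derivable1_diffP.
by have [] := d x.
Qed.

Lemma continuous_gauss_jet (R : realType) n (v : R) : 0 < v -> continuous (gauss_jet n v).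
Proof.
by move=> v0; apply: continuous_is_derive => x; exact: is_derive_gauss_jet.
Qed.

Lemma continuous_gauss (R : realType) (v : R) : 0 < v -> continuous (gauss v).
Proof. by move=> v0; apply: continuous_is_derive => x; exact: is_derive_gauss. Qed.

Lemma continuous_std_cdf (R : realType) : continuous (@std_cdf R).
Proof. by apply: continuous_is_derive => x; exact: is_derive_std_cdf. Qed.

Lemma continuous_affine_comp (R : realType) (f : R -> R) (a b : R) :
  continuous f -> continuous (fun x => f (b * (x - a))).
Proof.
move=> cf; have -> : (fun x => f (b * (x - a))) = f \o (fun x => - (b * a) + b * x).
  by apply/funext => x /=; congr f; ring.
move=> x; apply: continuous_comp; last exact: cf.
by apply: continuous_is_derive => y; exact: is_derive_affine.
Qed.

Lemma continuous_shift (R : realType) (f : R -> R) (a : R) :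
  continuous f -> continuous (fun x => f (x - a)).
Proof.
by move=> cf; have := @continuous_affine_comp _ _ a 1 cf; under eq_fun do rewrite mul1r.
Qed.

Lemma continuous_mulf (R : realType) (f g : R -> R) :
  continuous f -> continuous g -> continuous (fun x => f x * g x).
Proof. by move=> cf cg x; apply: cvgM; [exact: cf|exact: cg]. Qed.

Lemma continuous_sumf (R : realType) (J : Type) (s : seq J) (F : J -> R -> R) :
  (forall j, continuous (F j)) -> continuous (fun x => \sum_(j <- s) F j x).
Proof.
by move=> cF; apply: continuous_big => [|j _]; [exact: add_continuous|exact: cF].
Qed.

Lemma herm_free (R : realType) (v : R) (D : nat) (c : nat -> R) : 0 < v ->
  \sum_(n < D) c n *: herm v n = 0 -> forall n, (n < D)%N -> c n = 0.
Proof.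
move=> v0; elim: D => [//|D IH]; rewrite big_ord_recr/= => E.
have cD : c D = 0.
  move: E => /polyP /(_ D); rewrite coefD coefZ coef0 coef_sum big1 ?add0r.
    move=> /eqP; rewrite mulf_eq0 => /orP[/eqP //|/eqP h].
    have := lead_coef_eq0 (herm v D); rewrite lead_coefE size_herm//= h eqxx.
    by rewrite -size_poly_eq0 size_herm.
  by move=> i _; rewrite coefZ nth_default ?mulr0// size_herm.
move=> n; rewrite ltnS leq_eqVlt => /orP[/eqP -> //|]; apply: IH.
by move: E; rewrite cD scale0r addr0.
Qed.

Definition skew_half (R : realType) (th v l x : R) : R :=
  gauss v (x - th) * std_cdf (l * (x - th)).

Lemma continuous_skew_half (R : realType) (th v l : R) : 0 < v ->
  continuous (skew_half th v l).
Proof.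
move=> v0; apply: continuous_mulf; first exact: continuous_shift (continuous_gauss v0).
exact: continuous_affine_comp (@continuous_std_cdf R).
Qed.

Lemma integrable_skew_half (R : realType) (th v l : R) : 0 < v ->
  lebesgue_measure.-integrable setT (EFin \o skew_half th v l).
Proof.
move=> v0; have ig : lebesgue_measure.-integrable setT
    (EFin \o (fun x : R => gauss v (x - th))).
  have := @integrable_normal_pdf R th (Num.sqrt v).
  suff -> : (fun x : R => (normal_pdf th (Num.sqrt v) x)%:E) =
      (EFin \o (fun x : R => gauss v (x - th))) by [].
  apply/funext => x /=; congr EFin.
  rewrite normal_pdfE ?gt_eqF ?sqrtr_gt0// /normal_peak /normal_fun /gauss.
  rewrite sqr_sqrtr ?ltW// -[_ * pi *+ 2]mulr_natr -[v *+ 2]mulr_natr.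
  by congr ((Num.sqrt _)^-1 * expR _); [ring|rewrite mulNr; congr (- (_ / _)); ring].
apply: (le_integrable _ _ _ ig) => //.
  apply/measurable_realfun.measurable_EFinP; apply: measurable_realfun.continuous_measurable_fun.
  exact: continuous_skew_half.
move=> x _; rewrite /= lee_fin /skew_half normrM ler_piMr//.
by rewrite ger0_norm ?std_cdf_ge0// std_cdf_le1.
Qed.

(** Two bases are used: jets in front of [std_cdf], where the coefficients are those of the system,
    and monomials in front of the Gaussian product, where one degree is singled out. *)
Lemma skew_dual_functional (R : realType) (n0 : nat) (th v l : 'I_n0 -> R)
    (D1 D2 : nat) (bP bQ : 'I_n0 -> nat -> R) :
  (forall i, 0 < v i) -> injective v ->
  (forall i, l i != 0) ->
  (forall i j, (v i)^-1 + l i ^+ 2 != (v j)^-1) ->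
  (forall i j, (v i)^-1 + l i ^+ 2 = (v j)^-1 + l j ^+ 2 -> th i = th j -> i = j) ->
  exists (L : (R -> R) -> R) (C M : R),
    [/\ 0 < C,
        forall (a : R) (g h : R -> R), continuous g -> continuous h ->
          L (fun x => a * g x + h x) = a * L g + L h,
        forall (g : R -> R) (e : R), continuous g ->
          (forall x, `|x| <= M -> `|g x| <= e) -> `|L g| <= C * e,
        forall g : R -> R, continuous g ->
          lebesgue_measure.-integrable setT (EFin \o g) ->
          `|L g| <= C * \int[lebesgue_measure]_x `|g x| &
        (forall i n, (n < D1)%N -> L (fun x => gauss_jet n (v i) (x - th i) *
           std_cdf (l i * (x - th i))) = bP i n) /\
        (forall i n, (n < D2)%N -> L (fun x => (x - th i) ^+ n *
           (gauss (v i) (x - th i) * gauss 1 (l i * (x - th i)))) = bQ i n)].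
Proof.
move=> v0 vI l0 conf distinct.
pose I : finType := ('I_n0 * 'I_D1 + 'I_n0 * 'I_D2)%type.
pose B (k : I) (x : R) := match k with
  | inl (i, n) => gauss_jet n (v i) (x - th i) * std_cdf (l i * (x - th i))
  | inr (i, n) => (x - th i) ^+ n *
     (gauss (v i) (x - th i) * gauss 1 (l i * (x - th i))) end.
pose b (k : I) := match k with inl (i, n) => bP i n | inr (i, n) => bQ i n end.
have cB k : continuous (B k).
  case: k => -[i n] /=; apply: continuous_mulf.
  - exact: continuous_shift (continuous_gauss_jet (v0 i)).
  - exact: continuous_affine_comp (@continuous_std_cdf R).
  - exact: continuous_shift (@exprn_continuous R n).
  - apply: continuous_mulf; first exact: continuous_shift (continuous_gauss (v0 i)).
    exact: continuous_affine_comp (continuous_gauss ltr01).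
(* A relation regroups into polynomials [P i] and [Q i]. [insub] extends the coefficients by zero to
   all of [nat], the index type of [herm_free] and of polynomial coefficients. *)
have indep (c : I -> R) : (forall x, \sum_k c k * B k x = 0) -> forall k, c k = 0.
  move=> c0.
  pose c1 i n := if insub n is Some n' then c (inl (i, n')) else 0.
  pose P i := \sum_(n < D1) c1 i n *: herm (v i) n.
  pose Q i := \poly_(n < D2) if insub n is Some n' then c (inr (i, n')) else 0.
  have := @skew_terms_independent R n0 th v l P Q v0 vI l0 conf distinct.
  have H x : \sum_i gauss (v i) (x - th i) *
     ((P i).[x - th i] * std_cdf (l i * (x - th i)) +
      (Q i).[x - th i] * gauss 1 (l i * (x - th i))) = 0.
    rewrite -[RHS](c0 x) big_sumType/=.
    have -> : \sum_k c (inl k) * B (inl k) x =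
        \sum_i \sum_n c (inl (i, n)) * B (inl (i, n)) x.
      by rewrite pair_big/=; apply: eq_bigr => -[i n].
    have -> : \sum_k c (inr k) * B (inr k) x =
        \sum_i \sum_n c (inr (i, n)) * B (inr (i, n)) x.
      by rewrite pair_big/=; apply: eq_bigr => -[i n].
    rewrite -big_split/=; apply: eq_bigr => i _.
    rewrite mulrDr; congr (_ + _).
      rewrite /P horner_sum mulr_suml mulr_sumr; apply: eq_bigr => n _.
      by rewrite hornerZ /c1 valK /gauss_jet; ring.
    rewrite horner_poly mulr_suml mulr_sumr; apply: eq_bigr => n _.
    by rewrite valK; ring.
  move=> /(_ H) PQ; case=> -[i n].
    have [P0 _] := PQ i.
    by have := herm_free (v0 i) P0 (ltn_ord n); rewrite /c1 valK.
  have [_ /polyP /(_ n)] := PQ i.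
  by rewrite coef_poly ltn_ord valK coef0.
have [L [C [M [C0 lin sup l1 dual]]]] := dual_functional b cB indep.
exists L, C, M; split => //; split=> i n nD.
  exact: (dual (inl (i, Ordinal nD))).
exact: (dual (inr (i, Ordinal nD))).
Qed.

(* [q] collects the terms of the expansion that carry the density, rather than the
   distribution function, of the slanting factor. *)
Definition skew_expansion (R : realType) (r s : nat)
    (q : R -> R -> R -> R -> R -> {poly R}) : Prop :=
  forall B v0 l0 : R, 0 < v0 -> 0 <= B ->
  exists C d : R, [/\ 0 < C, 0 < d & forall y dt b dl T, `|y| <= B ->
    0 <= T -> T <= d -> `|dt| <= T -> `|b| <= T ^+ 2 -> `|dl| <= T ->
    `|gauss (v0 + 2 * b) (y - dt) * std_cdf ((l0 + dl) * (y - dt)) -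
      (gauss_taylor r v0 dt b y * std_cdf (l0 * y) +
       (q v0 l0 dt b dl).[y] * (gauss v0 y * gauss 1 (l0 * y)))| <= C * T ^+ s].

Lemma skew_expansion_uniform (R : realType) (r s : nat) q (n0 : nat)
    (th v l : 'I_n0 -> R) (M : R) :
  skew_expansion r s q -> (forall i, 0 < v i) ->
  exists C d : R, [/\ 0 < C, 0 < d & forall i x dt b dl T, `|x| <= M ->
    0 <= T -> T <= d -> `|dt| <= T -> `|b| <= T ^+ 2 -> `|dl| <= T ->
    v i / 2 <= v i + 2 * b /\
    `|skew_half (th i + dt) (v i + 2 * b) (l i + dl) x -
      (gauss_taylor r (v i) dt b (x - th i) * std_cdf (l i * (x - th i)) +
       (q (v i) (l i) dt b dl).[x - th i] *
         (gauss (v i) (x - th i) * gauss 1 (l i * (x - th i))))| <= C * T ^+ s].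
Proof.
move=> ex v0.
have H i : exists Cd : R * R, [/\ 0 < Cd.1, 0 < Cd.2 & forall x dt b dl T, `|x| <= M ->
    0 <= T -> T <= Cd.2 -> `|dt| <= T -> `|b| <= T ^+ 2 -> `|dl| <= T ->
    v i / 2 <= v i + 2 * b /\
    `|skew_half (th i + dt) (v i + 2 * b) (l i + dl) x -
      (gauss_taylor r (v i) dt b (x - th i) * std_cdf (l i * (x - th i)) +
       (q (v i) (l i) dt b dl).[x - th i] *
         (gauss (v i) (x - th i) * gauss 1 (l i * (x - th i))))| <= Cd.1 * T ^+ s].
  (* The expansion is centred at [th i], so [|x| <= M] becomes this bound on [x - th i]. *)
  have B0 : 0 <= `|M| + `|th i| by rewrite addr_ge0.
  have [C [d [C0 d0 E]]] := ex _ _ (l i) (v0 i) B0.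
  exists (C, Num.min d (Num.min 1 (v i / 4))); split => //=.
    by rewrite !lt_min d0 ltr01 divr_gt0.
  move=> x dt b dl T xM T0; rewrite !le_min => /and3P[Td T1 Tv] dtT bT dlT.
  split.
    have T2 : T ^+ 2 <= T by rewrite expr2 ler_piMl.
    have : `|b| <= v i / 4 by rewrite (le_trans bT)// (le_trans T2).
    by rewrite ler_norml => /andP[h _]; lra.
  have -> : skew_half (th i + dt) (v i + 2 * b) (l i + dl) x =
      gauss (v i + 2 * b) (x - th i - dt) * std_cdf ((l i + dl) * (x - th i - dt)).
    by rewrite /skew_half !opprD !addrA.
  apply: E => //; rewrite (le_trans (ler_normB _ _))// lerD//.
  by rewrite (le_trans xM)// ler_norm.
have [Cd CdP] := choice H.
pose C := 1 + \sum_i (Cd i).1; pose d := \big[Num.min/1]_i (Cd i).2.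
have Ci i : (Cd i).1 <= C.
  rewrite /C (bigD1 i)//= addrCA lerDl addr_ge0// sumr_ge0// => j _.
  by have [/ltW] := CdP j.
have di i : d <= (Cd i).2 by rewrite /d (bigD1 i)//= ge_min lexx.
exists C, d; split.
- by rewrite ltr_pwDl// sumr_ge0// => i _; have [/ltW] := CdP i.
- by rewrite /d; elim/big_ind: _ => // [x y x0 y0|i _];
    [rewrite lt_min x0|have [] := CdP i].
move=> i x dt b dl T xM T0 Td dtT bT dlT; have [_ _ E] := CdP i.
have [h1 h2] := E x dt b dl T xM T0 (le_trans Td (di i)) dtT bT dlT.
by split=> //; rewrite (le_trans h2)// ler_wpM2r ?exprn_ge0.
Qed.

Lemma linear_functional_sum (R : realType) (L : (R -> R) -> R) (J : Type)
    (s : seq J) (c : J -> R) (F : J -> R -> R) :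
  (forall (a : R) (g h : R -> R), continuous g -> continuous h ->
    L (fun x => a * g x + h x) = a * L g + L h) ->
  (forall j, continuous (F j)) ->
  L (fun x => \sum_(j <- s) c j * F j x) = \sum_(j <- s) c j * L (F j).
Proof.
move=> lin cF.
have c0 : continuous (fun _ : R => 0 : R) by exact: cst_continuous.
have L0 : L (fun=> 0) = 0.
  have := lin 1 _ _ c0 c0; rewrite mulr0 add0r mul1r => /eqP.
  by rewrite -subr_eq0 opprD addrA subrr sub0r oppr_eq0 => /eqP.
elim: s => [|j s IH].
  by rewrite big_nil -[RHS]L0; congr L; apply/funext => x; rewrite big_nil.
under eq_fun do rewrite big_cons.
rewrite big_cons lin//; first by rewrite IH.
apply: continuous_sumf => i; apply: continuous_mulf; last exact: cF.
exact: cst_continuous.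
Qed.

Lemma integrable_lincomb (R : realType) (J : Type) (s : seq J) (c : J -> R)
    (F : J -> R -> R) :
  (forall j, lebesgue_measure.-integrable setT (EFin \o F j)) ->
  lebesgue_measure.-integrable setT (EFin \o (fun x => \sum_(j <- s) c j * F j x)).
Proof.
move=> iF; elim: s => [|j s IH].
  have -> : EFin \o (fun x => \sum_(j <- [::]) c j * F j x) = cst 0%E.
    by apply/funext => x /=; rewrite big_nil.
  exact: integrable0.
have -> : EFin \o (fun x => \sum_(i <- j :: s) c i * F i x) =
    ((fun x => (c j)%:E * (F j x)%:E) \+
     (EFin \o (fun x => \sum_(i <- s) c i * F i x)%R))%E.
  by apply/funext => x /=; rewrite big_cons EFinD EFinM.
by apply: integrableD => //; apply: integrableZl => //; exact: iF.
Qed.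

(** [L] is applied to the Taylor polynomials, on which its values are prescribed; the passage to the
    true densities costs one remainder, estimated only where [L] integrates. *)
Lemma skew_functional_estimate (R : realType) (r s D2 : nat) q (n0 : nat)
    (th v l : 'I_n0 -> R) (bP bQ : 'I_n0 -> nat -> R) :
  (forall i, 0 < v i) -> injective v ->
  (forall i, l i != 0) ->
  (forall i j, (v i)^-1 + l i ^+ 2 != (v j)^-1) ->
  (forall i j, (v i)^-1 + l i ^+ 2 = (v j)^-1 + l j ^+ 2 -> th i = th j -> i = j) ->
  skew_expansion r s q ->
  (forall v0 l0 dt b dl, 0 < v0 -> (size (q v0 l0 dt b dl) <= D2)%N) ->
  exists K d : R, [/\ 0 < K, 0 < d &
    forall (J : finType) (g : J -> 'I_n0) (w dt b dl : J -> R) (w0 : 'I_n0 -> R) T,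
    (forall j, 0 <= w j) -> \sum_j w j = 1 -> 0 <= T -> T <= d ->
    (forall j, `|dt j| <= T) -> (forall j, `|b j| <= T ^+ 2) ->
    (forall j, `|dl j| <= T) ->
    `|\sum_j w j * (\sum_(n < (3 * r).+1) heat_coef r n (dt j) (b j) * bP (g j) n +
        \sum_(n < D2) (q (v (g j)) (l (g j)) (dt j) (b j) (dl j))`_n * bQ (g j) n) -
      \sum_i w0 i * bP i 0%N| <=
    K * (\int[lebesgue_measure]_x
      `|\sum_j w j * skew_half (th (g j) + dt j) (v (g j) + 2 * b j) (l (g j) + dl j) x -
        \sum_i w0 i * skew_half (th i) (v i) (l i) x| + T ^+ s)].
Proof.
move=> v0 vI l0 conf distinct ex qsz.
have [L [C [M [C0 lin sup l1 [dP dQ]]]]] :=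
  skew_dual_functional (3 * r).+1 D2 bP bQ v0 vI l0 conf distinct.
have [C1 [d [C10 d0 E]]] := skew_expansion_uniform th l `|M| ex v0.
exists (C * (1 + C1)), d; split => //; first by rewrite mulr_gt0// addr_gt0.
move=> J g w dt b dl w0 T w_ge0 w1 T0 Td dtT bT dlT.
pose F j := skew_half (th (g j) + dt j) (v (g j) + 2 * b j) (l (g j) + dl j).
pose f0 i := skew_half (th i) (v i) (l i).
pose jet i n x := gauss_jet n (v i) (x - th i) * std_cdf (l i * (x - th i)).
pose mono i n x := (x - th i) ^+ n *
  (gauss (v i) (x - th i) * gauss 1 (l i * (x - th i))).
pose qq j := q (v (g j)) (l (g j)) (dt j) (b j) (dl j).
pose A1 j x := \sum_(n < (3 * r).+1) heat_coef r n (dt j) (b j) * jet (g j) n x.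
pose A2 j x := \sum_(n < D2) (qq j)`_n * mono (g j) n x.
pose A j x := 1 * A1 j x + A2 j x.
have FA j x : `|x| <= `|M| -> v (g j) / 2 <= v (g j) + 2 * b j /\
    `|F j x - A j x| <= C1 * T ^+ s.
  move=> xM; have [h1 h2] := E (g j) x _ _ _ T xM T0 Td (dtT j) (bT j) (dlT j).
  split=> //; rewrite (le_trans _ h2)// le_eqVlt; apply/orP; left; apply/eqP.
  congr (`|_ - _|); rewrite /A mul1r /A1 /A2; congr (_ + _).
    by rewrite gauss_taylorE mulr_suml; apply: eq_bigr => n _; rewrite mulrA.
  rewrite (horner_coef_wide _ (qsz _ _ _ _ _ (v0 _))) mulr_suml.
  by apply: eq_bigr => n _; rewrite mulrA.
have vj0 j : 0 < v (g j) + 2 * b j.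
  have [|h _] := FA j 0; first by rewrite normr0.
  by apply: lt_le_trans h; rewrite divr_gt0.
have cjet i n : continuous (jet i n).
  apply: continuous_mulf; first exact: continuous_shift (continuous_gauss_jet (v0 i)).
  exact: continuous_affine_comp (@continuous_std_cdf R).
have cmono i n : continuous (mono i n).
  apply: continuous_mulf; first exact: continuous_shift (@exprn_continuous R n).
  apply: continuous_mulf; first exact: continuous_shift (continuous_gauss (v0 i)).
  exact: continuous_affine_comp (continuous_gauss ltr01).
have cscale (c : R) (f : R -> R) : continuous f -> continuous (fun x => c * f x).
  by move=> cf; apply: continuous_mulf => //; exact: cst_continuous.
have cF j : continuous (F j) by exact: continuous_skew_half.
have cf0 i : continuous (f0 i) by exact: continuous_skew_half.
have cA1 j : continuous (A1 j) by apply: continuous_sumf => n; exact: cscale.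
have cA2 j : continuous (A2 j) by apply: continuous_sumf => n; exact: cscale.
have cA j : continuous (A j).
  by move=> x; apply: cvgD; [exact: cscale|exact: cA2].
have LA j : L (A j) = \sum_(n < (3 * r).+1) heat_coef r n (dt j) (b j) * bP (g j) n +
    \sum_(n < D2) (qq j)`_n * bQ (g j) n.
  rewrite /A lin// mul1r /A1 /A2.
  rewrite (@linear_functional_sum _ _ 'I_(3 * r).+1 _ _ (fun n => jet (g j) n) lin)//.
  rewrite (@linear_functional_sum _ _ 'I_D2 _ _ (fun n => mono (g j) n) lin)//.
  by congr (_ + _); apply: eq_bigr => n _; [rewrite dP|rewrite dQ].
have Lf0 i : L (f0 i) = bP i 0%N.
  rewrite -(dP i 0%N)//; congr L; apply/funext => x.
  by rewrite /f0 /skew_half gauss_jet0.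
pose SF x := \sum_j w j * F j x.
pose S0 x := \sum_i w0 i * f0 i x.
pose SA x := \sum_j w j * A j x.
have cSF : continuous SF by apply: continuous_sumf => j; exact: cscale.
have cS0 : continuous S0 by apply: continuous_sumf => j; exact: cscale.
have cSA : continuous SA by apply: continuous_sumf => j; exact: cscale.
have cN (f h : R -> R) : continuous f -> continuous h ->
    continuous (fun x => -1 * f x + h x).
  by move=> cf ch x; apply: cvgD; [exact: cscale|exact: ch].
have LD := lin (-1) _ _ cS0 cSF; have LR := lin (-1) _ _ cSA cSF.
have LS0 : L S0 = \sum_i w0 i * bP i 0%N.
  rewrite /S0 (linear_functional_sum _ _ lin cf0).
  by apply: eq_bigr => i _; rewrite Lf0.
have LSA : L SA = \sum_j w j * (\sum_(n < (3 * r).+1) heat_coef r n (dt j) (b j) * bP (g j) n +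
    \sum_(n < D2) (qq j)`_n * bQ (g j) n).
  rewrite /SA (linear_functional_sum _ _ lin cA).
  by apply: eq_bigr => j _; rewrite LA.
rewrite -LSA -LS0.
(* The first difference is bounded through the [L1] norm, the second, a Taylor remainder, through
   the supremum bound. *)
have -> : L SA - L S0 = L (fun x => -1 * S0 x + SF x) - L (fun x => -1 * SA x + SF x).
  by rewrite LD LR; ring.
have T0s : 0 <= T ^+ s by rewrite exprn_ge0.
have int0 : 0 <= \int[lebesgue_measure]_x `|SF x - S0 x| by apply: Rintegral_ge0.
rewrite (le_trans (ler_normB _ _))// (@le_trans _ _
  (C * (\int[lebesgue_measure]_x `|SF x - S0 x|) + C * (C1 * T ^+ s)))//; last first.
  rewrite -mulrDr -mulrA ler_wpM2l ?(ltW C0)// mulrDl mul1r mulrDr.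
  rewrite addrACA lerD//; last by rewrite lerDr.
  by rewrite lerDl mulr_ge0// ltW.
apply: lerD.
  rewrite (le_trans (l1 _ (cN _ _ cS0 cSF) _))//.
    have -> : EFin \o (fun x => -1 * S0 x + SF x) = ((EFin \o SF) \- (EFin \o S0))%E.
      by apply/funext => x /=; rewrite mulN1r addrC EFinB.
    by apply: integrableB => //; apply: integrable_lincomb => j;
      exact: integrable_skew_half.
  by rewrite le_eqVlt; under eq_Rintegral do rewrite mulN1r addrC; rewrite eqxx.
apply: sup; first exact: cN.
move=> x xM; rewrite /SA /SF mulN1r addrC -sumrB (le_trans (ler_norm_sum _ _ _))//.
rewrite -[leRHS]mul1r -w1 mulr_suml; apply: ler_sum => j _.
rewrite -mulrBr normrM (ger0_norm (w_ge0 j)) ler_wpM2l//.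
by have [|_] := FA j x => //; rewrite (le_trans xM)// ler_norm.
Qed.

(** * Moment estimates *)

(* The coordinates are [(theta, sigma ^ 2, m / sigma)]: the variance then enters
   the Gaussian factor only, where it obeys the heat equation. *)
Definition generic_params (R : realType) (n0 : nat) (th v l : 'I_n0 -> R) : Prop :=
  [/\ forall i, 0 < v i, injective v, forall i, l i != 0,
      forall i j, (v i)^-1 + l i ^+ 2 != (v j)^-1 &
      forall i j, (v i)^-1 + l i ^+ 2 = (v j)^-1 + l j ^+ 2 -> th i = th j -> i = j].

Definition half_L1_dist (R : realType) (n0 : nat) (th v l : 'I_n0 -> R)
    (J : finType) (g : J -> 'I_n0) (w dt b dl : J -> R) (w0 : 'I_n0 -> R) : R :=
  \int[lebesgue_measure]_x
    `|\sum_j w j * skew_half (th (g j) + dt j) (v (g j) + 2 * b j) (l (g j) + dl j) x -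
      \sum_i w0 i * skew_half (th i) (v i) (l i) x|.

(* [b] is half the increment of the variance; by the heat equation it has the same
   weight as the square of the increment [dt] of the location. *)
Definition small_params (R : realType) (J : finType) (w dt b dl : J -> R) (d T : R) : Prop :=
  [/\ forall j, 0 <= w j, \sum_j w j = 1, 0 <= T <= d &
      forall j, [/\ `|dt j| <= T, `|b j| <= T ^+ 2 & `|dl j| <= T]].

(** The functional is dual to the jet of order [n] at atom [i] and kills all Gaussian products. The
    target mixture consists of jets of order zero, so its weight shows up only for [n = 0]. *)
Lemma weight_moment_estimate (R : realType) (r n0 : nat) (th v l : 'I_n0 -> R)
    (i : 'I_n0) (n : nat) :
  generic_params th v l -> (n <= r)%N ->
  exists K d : R, [/\ 0 < K, 0 < d &
    forall (J : finType) (g : J -> 'I_n0) (w dt b dl : J -> R) (w0 : 'I_n0 -> R) T,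
    small_params w dt b dl d T ->
    `|\sum_(j | g j == i) w j * heat_coef r n (dt j) (b j) - (n == 0%N)%:R * w0 i| <=
    K * (half_L1_dist th v l g w dt b dl w0 + T ^+ r.+1)].
Proof.
move=> [v0 vI l0 conf distinct] nr.
pose q (v0 l0 dt b dl : R) := gauss_taylor_poly r v0 dt b *
  cdf_taylor_poly r l0 (slant_shift l0 dt dl).
have ex : skew_expansion r r.+1 q by move=> *; exact: skew_taylor.
have qsz v1 l1 dt b dl : 0 < v1 -> (size (q v1 l1 dt b dl) <= (3 * r).+1 + (3 * r).+1)%N.
  move=> v10; rewrite (leq_trans (size_polyMleq _ _))// (leq_trans (leq_pred _))//.
  by rewrite leq_add ?size_gauss_taylor_poly ?size_cdf_taylor_poly ?size_slant_shift.
pose bP (i' : 'I_n0) (n' : nat) : R := ((i' == i) && (n' == n))%:R.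
have [K [d [K0 d0 E]]] := skew_functional_estimate bP (fun _ _ => 0)
  v0 vI l0 conf distinct ex qsz.
exists K, d; split=> // J g w dt b dl w0 T [w_ge0 w1 /andP[T0 Td] H].
have h1 j : `|dt j| <= T by have [] := H j.
have h2 j : `|b j| <= T ^+ 2 by have [] := H j.
have h3 j : `|dl j| <= T by have [] := H j.
apply: le_trans (E J g w dt b dl w0 T w_ge0 w1 T0 Td h1 h2 h3).
rewrite le_eqVlt; apply/orP; left; apply/eqP; congr (`|_ - _|); last first.
  rewrite (bigD1 i)//= big1 ?addr0; last first.
    by move=> i' /negbTE ii; rewrite /bP ii mulr0.
  by rewrite /bP eqxx/= mulrC eq_sym.
rewrite big_mkcond/=; apply: eq_bigr => j _.
rewrite [X in _ + X]big1 ?addr0; last by move=> ? _; rewrite mulr0.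
rewrite /bP; case: eqP => _ /=; last by rewrite big1 ?mulr0// => ? _; rewrite mulr0.
have nD : (n < (3 * r).+1)%N by lia.
rewrite (bigD1 (Ordinal nD))//= eqxx mulr1 big1 ?addr0// => n' /negbTE.
by rewrite -val_eqE/= => ->; rewrite mulr0.
Qed.

(** The functional is dual to the monomial of degree three at atom [i]; it kills every term with
    [std_cdf], including the whole target mixture. *)
Lemma slant_moment_estimate (R : realType) (n0 : nat) (th v l : 'I_n0 -> R)
    (i : 'I_n0) :
  generic_params th v l ->
  exists K d : R, [/\ 0 < K, 0 < d &
    forall (J : finType) (g : J -> 'I_n0) (w dt b dl : J -> R) (w0 : 'I_n0 -> R) T,
    small_params w dt b dl d T ->
    `|l i| / 2 * \sum_(j | g j == i) w j * dl j ^+ 2 <=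
    K * (half_L1_dist th v l g w dt b dl w0 + T ^+ 3)].
Proof.
move=> [v0 vI l0 conf distinct].
pose q (v0 l0 dt b dl : R) := slant_taylor_poly v0 l0 dt dl.
have ex : skew_expansion 2 3 q by move=> *; exact: skew_taylor_slant.
have qsz v1 l1 dt b dl : 0 < v1 -> (size (q v1 l1 dt b dl) <= 4)%N.
  by move=> _; exact: size_slant_taylor_poly.
pose bQ (i' : 'I_n0) (n' : nat) : R := ((i' == i) && (n' == 3))%:R.
have [K [d [K0 d0 E]]] := skew_functional_estimate (fun _ _ => 0) bQ
  v0 vI l0 conf distinct ex qsz.
exists K, d; split=> // J g w dt b dl w0 T [w_ge0 w1 /andP[T0 Td] H].
have h1 j : `|dt j| <= T by have [] := H j.
have h2 j : `|b j| <= T ^+ 2 by have [] := H j.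
have h3 j : `|dl j| <= T by have [] := H j.
apply: le_trans (E J g w dt b dl w0 T w_ge0 w1 T0 Td h1 h2 h3).
rewrite [X in `|_ - X|]big1 ?subr0; last by move=> ? _; rewrite mulr0.
rewrite [X in _ <= `|X|](_ : _ = - (l i / 2) * \sum_(j | g j == i) w j * dl j ^+ 2).
  rewrite normrM normrN normrM normfV normr_nat ler_wpM2l ?mulr_ge0 ?invr_ge0//.
  exact: ler_norm.
rewrite mulr_sumr [RHS]big_mkcond/=; apply: eq_bigr => j _.
rewrite big1 ?add0r; last by move=> ? _; rewrite mulr0.
rewrite /bQ; case: eqP => [<-|_] /=; last by rewrite big1 ?mulr0// => ? _; rewrite mulr0.
rewrite !big_ord_recr big_ord0/= !mulr0 !add0r mulr1 coef3_slant_taylor_poly.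
by ring.
Qed.

Lemma uniform_constants (R : realType) (I : finType) (P : I -> R -> R -> Prop) :
  (forall i, exists K d : R, [/\ 0 < K, 0 < d & P i K d]) ->
  (forall i K K' d d', K <= K' -> d' <= d -> P i K d -> P i K' d') ->
  exists K d : R, [/\ 0 < K, 0 < d & forall i, P i K d].
Proof.
move=> ex mono.
have H i : exists Kd : R * R, [/\ 0 < Kd.1, 0 < Kd.2 & P i Kd.1 Kd.2].
  by have [K [d h]] := ex i; exists (K, d).
have [Kd KdP] := choice H.
exists (1 + \sum_i (Kd i).1), (\big[Num.min/1]_i (Kd i).2); split.
- by rewrite ltr_pwDl// sumr_ge0// => i _; have [/ltW] := KdP i.
- by elim/big_ind: _ => // [x y x0 y0|i _]; [rewrite lt_min x0|have [] := KdP i].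
move=> i; have [_ _] := KdP i; apply: mono.
- rewrite (bigD1 i)//= addrCA lerDl addr_ge0// sumr_ge0// => j _.
  by have [/ltW] := KdP j.
- by rewrite (bigD1 i)//= ge_min lexx.
Qed.

Lemma moment_estimates (R : realType) (r n0 : nat) (th v l : 'I_n0 -> R) :
  generic_params th v l ->
  exists K d : R, [/\ 0 < K, 0 < d &
    forall (J : finType) (g : J -> 'I_n0) (w dt b dl : J -> R) (w0 : 'I_n0 -> R) T,
    small_params w dt b dl d T ->
    (forall i n, (n <= r)%N ->
      `|\sum_(j | g j == i) w j * heat_coef r n (dt j) (b j) - (n == 0%N)%:R * w0 i| <=
      K * (half_L1_dist th v l g w dt b dl w0 + T ^+ r.+1)) /\
    (forall i, `|l i| / 2 * \sum_(j | g j == i) w j * dl j ^+ 2 <=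
      K * (half_L1_dist th v l g w dt b dl w0 + T ^+ 3))].
Proof.
move=> gen.
have spW (J : finType) (w dt b dl : J -> R) (d d' T : R) : d' <= d ->
    small_params w dt b dl d' T -> small_params w dt b dl d T.
  by move=> dd [h1 h2 /andP[h3 h4] h5]; split=> //; rewrite h3 (le_trans h4).
have L0 (J : finType) (g : J -> 'I_n0) (w dt b dl : J -> R) (w0 : 'I_n0 -> R) :
  0 <= half_L1_dist th v l g w dt b dl w0 by apply: Rintegral_ge0.
have T0 (J : finType) (w dt b dl : J -> R) d T : small_params w dt b dl d T -> 0 <= T.
  by case=> _ _ /andP[].
pose PP (k : 'I_n0 * 'I_r.+1) (K d : R) :=
  forall (J : finType) (g : J -> 'I_n0) (w dt b dl : J -> R) (w0 : 'I_n0 -> R) T,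
    small_params w dt b dl d T ->
    `|\sum_(j | g j == k.1) w j * heat_coef r k.2 (dt j) (b j) -
        (k.2 == 0%N :> nat)%:R * w0 k.1| <=
      K * (half_L1_dist th v l g w dt b dl w0 + T ^+ r.+1).
pose PQ (i : 'I_n0) (K d : R) :=
  forall (J : finType) (g : J -> 'I_n0) (w dt b dl : J -> R) (w0 : 'I_n0 -> R) T,
    small_params w dt b dl d T ->
    `|l i| / 2 * \sum_(j | g j == i) w j * dl j ^+ 2 <=
      K * (half_L1_dist th v l g w dt b dl w0 + T ^+ 3).
have [K1 [d1 [K10 d10 H1]]] : exists K d : R, [/\ 0 < K, 0 < d & forall k, PP k K d].
  apply: uniform_constants => [[i n]|k K K' d d' KK dd H J g w dt b dl w0 T sp].
    by apply: weight_moment_estimate => //; rewrite -ltnS.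
  rewrite (le_trans (H J g w dt b dl w0 T (spW _ _ _ _ _ _ _ _ dd sp)))//.
  by rewrite ler_wpM2r// addr_ge0// exprn_ge0// (T0 _ _ _ _ _ _ _ sp).
have [K2 [d2 [K20 d20 H2]]] : exists K d : R, [/\ 0 < K, 0 < d & forall k, PQ k K d].
  apply: uniform_constants => [i|k K K' d d' KK dd H J g w dt b dl w0 T sp].
    exact: slant_moment_estimate.
  rewrite (le_trans (H J g w dt b dl w0 T (spW _ _ _ _ _ _ _ _ dd sp)))//.
  by rewrite ler_wpM2r// addr_ge0// exprn_ge0// (T0 _ _ _ _ _ _ _ sp).
exists (K1 + K2), (Num.min d1 d2); split; [exact: addr_gt0|by rewrite lt_min d10|].
move=> J g w dt b dl w0 T sp.
have sp1 : small_params w dt b dl d1 T by apply: spW sp; rewrite ge_min lexx.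
have sp2 : small_params w dt b dl d2 T by apply: spW sp; rewrite ge_min lexx orbT.
have Tge := T0 _ _ _ _ _ _ _ sp; split=> [i n nr|i].
  have nr' : (n < r.+1)%N by [].
  rewrite (le_trans (H1 (i, Ordinal nr') J g w dt b dl w0 T sp1))//.
  by rewrite ler_wpM2r ?addr_ge0 ?exprn_ge0// lerDl ltW.
rewrite (le_trans (H2 i J g w dt b dl w0 T sp2))//.
by rewrite ler_wpM2r ?addr_ge0 ?exprn_ge0// lerDr ltW.
Qed.

(** * Groups of atoms and comparison of coordinates *)

(** Each of the other fibres has at least one element. This is the origin of the number [k - k0 + 1]
    of unknowns in the system. *)
Lemma card_fiber_le (J I : finType) (g : J -> I) : (forall i, exists j, g j = i) ->
  forall i, (#|[set j | g j == i]%SET| + #|I| <= #|J|.+1)%N.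
Proof.
move=> surj i.
have cJ : #|J| = (\sum_i #|[set j | g j == i]%SET|)%N.
  rewrite -sum1_card (partition_big g xpredT)//=; apply: eq_bigr => i' _.
  exact: sum1dep_card.
rewrite cJ (bigD1 i)//= -addnS leq_add2l.
have -> : #|I| = (\sum_(i' | i' != i) 1).+1.
  by rewrite -sum1_card (bigD1 i)//= add1n.
rewrite ltnS; apply: leq_sum => i' _; rewrite card_gt0; apply/set0Pn.
by have [j gj] := surj i'; exists j; rewrite inE gj.
Qed.

Lemma slant_ratio_near (R : realType) (m0 v0 d : R) : 0 < v0 -> 0 < d ->
  exists2 e : R, 0 < e & forall m v, `|m - m0| <= e -> `|v - v0| <= e ->
    `|m / Num.sqrt v - m0 / Num.sqrt v0| <= d.
Proof.
move=> v00 d0; have s0 : Num.sqrt v0 != 0 by rewrite gt_eqF// sqrtr_gt0.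
have cont : continuous_at ((m0, v0) : R * R) (fun x : R * R => x.1 / Num.sqrt x.2).
  apply: cvgM; first exact: cvg_fst.
  apply: cvgV => //; apply: (@continuous_comp _ _ _ snd Num.sqrt); first exact: cvg_snd.
  exact: sqrt_continuous.
have /cvgrPdist_le /(_ d d0) := cont.
move=> /nbhs_ballP[e /= e0 H]; exists (e / 2); first by rewrite divr_gt0.
move=> m v me ve; rewrite distrC; apply: (H (m, v)).
by split=> /=; rewrite -ball_normE /= distrC; rewrite (le_lt_trans _ (_ : e / 2 < e))//;
  rewrite ltr_pdivrMr// ltr_pMr// ltr1n.
Qed.

(** A majorant of [param_dist] whose triangle inequality is a matter of coordinates. *)
Definition param_dist1 (R : realType) (e e' : skew_param R) : R :=
  `|location e - location e'| + `|slant e - slant e'| + `|sqscale e - sqscale e'|.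

Lemma param_dist_le1 (R : realType) (e e' : skew_param R) :
  param_dist e e' <= param_dist1 e e'.
Proof.
rewrite lerD2r -(ler_pXn2r (ltn0Sn 1)) ?nnegrE ?sqrtr_ge0 ?addr_ge0//.
rewrite sqr_sqrtr ?addr_ge0 ?sqr_ge0// [leRHS]sqrrD !real_normK ?num_real//.
by rewrite addrAC lerDl mulrn_wge0// mulr_ge0.
Qed.

Lemma param_dist_coord (R : realType) (e e' : skew_param R) rho :
  param_dist e e' <= rho ->
  [/\ `|location e - location e'| <= rho, `|slant e - slant e'| <= rho &
      `|sqscale e - sqscale e'| <= rho].
Proof.
have sq (x y : R) : `|x| <= Num.sqrt (x ^+ 2 + y ^+ 2).
  by rewrite -sqrtr_sqr ler_sqrt ?addr_ge0 ?sqr_ge0// lerDl sqr_ge0.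
move=> H; split; apply: le_trans H; rewrite /param_dist.
- by rewrite (le_trans (sq _ (slant e - slant e')))// lerDl.
- rewrite (le_trans (sq _ (location e - location e')))//.
  by rewrite [(slant e - slant e') ^+ 2 + _]addrC lerDl.
- by rewrite lerDr sqrtr_ge0.
Qed.

Lemma param_dist1_triangle (R : realType) (e e' e'' : skew_param R) :
  param_dist1 e e'' <= param_dist1 e e' + param_dist1 e' e''.
Proof.
rewrite /param_dist1.
have := ler_distD (location e') (location e) (location e'').
have := ler_distD (slant e') (slant e) (slant e'').
have := ler_distD (sqscale e') (sqscale e) (sqscale e'').
lra.
Qed.

(** Undoes the change of coordinates [l = m / sigma]: the slant is recovered as the product
    [l * sigma]. *)
Lemma param_dist_le_local (R : realType) (e0 : skew_param R) : 0 < sqscale e0 ->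
  exists2 C : R, 0 < C & forall (e : skew_param R) T,
    0 < sqscale e -> 0 <= T -> T <= 1 -> T <= sqscale e0 / 4 ->
    `|location e - location e0| <= T -> `|(sqscale e - sqscale e0) / 2| <= T ^+ 2 ->
    `|slant e / Num.sqrt (sqscale e) - slant e0 / Num.sqrt (sqscale e0)| <= T ->
    param_dist e e0 <= C * T.
Proof.
move=> v00; set v0 := sqscale e0 in v00 *; set m0 := slant e0.
have s0 : 0 < Num.sqrt v0 by rewrite sqrtr_gt0.
(* From [m - m0 = (l - l0) * sigma + l0 * (sigma - sigma0)], with [sigma ^ 2 <= 2 * v0] and
   [|sigma - sigma0| <= 2 * T / sigma0]. *)
pose C1 := Num.sqrt (2 * v0) + `|m0 / Num.sqrt v0| * (2 / Num.sqrt v0).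
have C10 : 0 <= C1 by rewrite addr_ge0 ?sqrtr_ge0// mulr_ge0// divr_ge0// ltW.
exists (1 + C1 + 2); first by rewrite -addrA ltr_pwDl// addr_ge0.
move=> e T; set v := sqscale e; set m := slant e => ve T0 T1 Tv dtT bT dlT.
have sv : 0 < Num.sqrt v by rewrite sqrtr_gt0.
have T2 : T ^+ 2 <= T by rewrite expr2 ler_piMl.
have vv : `|v - v0| <= 2 * T.
  have : `|(v - v0) / 2| <= T by exact: le_trans T2.
  by rewrite normrM normfV normr_nat ler_pdivrMr// mulrC.
have v2 : v <= 2 * v0 by move: vv; rewrite ler_norml => /andP[_]; lra.
have ss : `|Num.sqrt v - Num.sqrt v0| <= 2 * T / Num.sqrt v0.
  rewrite ler_pdivlMr// (le_trans _ vv)//.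
  have -> : v - v0 = (Num.sqrt v - Num.sqrt v0) * (Num.sqrt v + Num.sqrt v0).
    by rewrite -subr_sqr !sqr_sqrtr// ltW.
  rewrite normrM ler_wpM2l// (@ger0_norm _ (_ + _)) ?addr_ge0 ?ltW//.
  by rewrite ltrDr.
have mm : `|m - m0| <= C1 * T.
  have -> : m - m0 = (m / Num.sqrt v - m0 / Num.sqrt v0) * Num.sqrt v +
      m0 / Num.sqrt v0 * (Num.sqrt v - Num.sqrt v0).
    by field; rewrite !gt_eqF.
  rewrite (le_trans (ler_normD _ _))// /C1 [leRHS]mulrDl lerD//.
    rewrite normrM mulrC ler_pM//.
    by rewrite ger0_norm ?sqrtr_ge0// ler_sqrt// mulr_ge0// ltW.
  by rewrite normrM -mulrA ler_wpM2l// mulrAC.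
rewrite (le_trans (param_dist_le1 _ _))// /param_dist1.
have -> : (1 + C1 + 2) * T = T + C1 * T + 2 * T by ring.
exact: lerD (lerD dtT mm) vv.
Qed.

Lemma heat_coef0 (R : realType) (r : nat) (a b : R) : heat_coef r 0 a b = 1.
Proof.
rewrite heat_coef_widen// /heat_coef !big_ord_recl !big_ord0/= !expr0 fact0.
by rewrite !addr0 invr1 !mulr1.
Qed.

(** * From moments to the inequality *)

Lemma moment_lower_bound (R : realType) (r rbar N n0 : nat) (th v l : 'I_n0 -> R)
    (c0 : R) :
  generic_params th v l -> (2 <= N)%N -> is_rbar R N rbar -> (rbar <= r)%N ->
  (2 <= r)%N -> 0 < c0 -> c0 <= 1 ->
  exists K d : R, [/\ 0 < K, 0 < d &
    forall (J : finType) (g : J -> 'I_n0) (w dt b dl : J -> R) (w0 : 'I_n0 -> R) T,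
    small_params w dt b dl d T -> (forall j, c0 <= w j) ->
    (forall i, #|[set j | g j == i]%SET| <= N)%N ->
    (T = 0 \/ exists j, [\/ `|dt j| = T, `|b j| = T ^+ 2 | `|dl j| = T]) ->
    T ^+ r <= K * half_L1_dist th v l g w dt b dl w0 /\
    (forall i, `|\sum_(j | g j == i) w j - w0 i| <=
       K * half_L1_dist th v l g w dt b dl w0)].
Proof.
move=> gen N2 rP rr r2 c00 c01.
have [K [d [K0 d0 H]]] := moment_estimates r gen.
have [c cc0 hgb] := heat_group_bound N2 rP c00 c01.
pose la := \big[Num.min/1]_i `|l i|.
have l_neq0 : forall i, l i != 0 by case: gen.
have la0 : 0 < la.
  rewrite /la; elim/big_ind: _ => // [x y x0 y0|i _]; first by rewrite lt_min x0.
  by rewrite normr_gt0.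
have la_le i : la <= `|l i| by rewrite /la (bigD1 i)//= ge_min lexx.
have lc0 : 0 < la * c0 by rewrite mulr_gt0.
(* One summand for each case: [T] attained by [dt] or [b], or by [dl]. The last two bounds in [d1]
   make the Taylor remainder at most half of the main term in the corresponding case. *)
pose K1 := 2 * K / c + 4 * K / (la * c0).
have K10 : 0 < K1 by rewrite addr_gt0// divr_gt0// mulr_gt0.
pose d1 := Num.min d (Num.min 1 (Num.min (c / (2 * K)) (la * c0 / (4 * K)))).
exists (K * (1 + K1) + K1), d1; split.
- by rewrite addr_gt0// mulr_gt0// addr_gt0.
- by rewrite !lt_min d0 ltr01/= !divr_gt0// mulr_gt0.
move=> J g w dt b dl w0 T [w_ge0 w1 /andP[T0]]; rewrite !le_min.
move=> /and4P[Td T1 Tc Tl] small wc0 cardN attained.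
have sp : small_params w dt b dl d T by split=> //; rewrite T0.
have [EP EQ] := H J g w dt b dl w0 T sp.
set h := half_L1_dist th v l g w dt b dl w0 in EP EQ *.
have h0 : 0 <= h by exact: Rintegral_ge0.
have TK1 : T ^+ r <= K1 * h.
  have [->|Tn0] := eqVneq T 0.
    by rewrite expr0n gtn_eqF ?(ltnW r2)// mulr_ge0// ltW.
  have Tp : 0 < T by rewrite lt_neqAle eq_sym Tn0.
  case: attained => [/eqP|[j jT]]; first by rewrite (negbTE Tn0).
  pose A := [set j' | g j' == g j]%SET.
  have jA : j \in A by rewrite inE.
  have heat_case : `|dt j| = T \/ `|b j| = T ^+ 2 -> T ^+ r <= K1 * h.
    move=> jT'; have [||||n /andP[n1 nr] cn] := hgb J A w dt b T (cardN (g j)) Tp.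
    - move=> j' _; rewrite wc0/= -w1 (bigD1 j')//= lerDl; exact: sumr_ge0.
    - by move=> j' _; have [] := small j'.
    - by move=> j' _; have [] := small j'.
    - by exists j.
    have := EP (g j) n (leq_trans nr rr).
    rewrite gtn_eqF// mul0r subr0.
    have -> : \sum_(j' | g j' == g j) w j' * heat_coef r n (dt j') (b j') =
        \sum_(j' in A) w j' * heat_coef n n (dt j') (b j').
      apply: eq_big => [j'|j' _]; first by rewrite inE.
      by rewrite heat_coef_widen// (leq_trans nr rr).
    move=> /(le_trans cn) cn'.
    (* The order [n] is not under control, but [n <= rbar <= r] and [T <= 1] allow passing to the
       power [r]. *)
    have cr : c * T ^+ r <= K * (h + T ^+ r.+1).
      apply: le_trans cn'; rewrite ler_wpM2l ?(ltW cc0)// ler_wiXn2l//.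
      exact: leq_trans rr.
    have KT : K * T ^+ r.+1 <= c / 2 * T ^+ r.
      rewrite exprS mulrA ler_wpM2r ?exprn_ge0//.
      by move: Tc; rewrite ler_pdivlMr ?mulr_gt0//; lra.
    have : c / 2 * T ^+ r <= K * h by move: cr; rewrite mulrDr; lra.
    rewrite -ler_pdivlMl ?divr_gt0// => /le_trans; apply.
    have -> : (c / 2)^-1 * (K * h) = 2 * K / c * h by field; rewrite gt_eqF.
    by rewrite ler_wpM2r// lerDl ltW// divr_gt0// mulr_gt0.
  case: jT => [jT|jT|jT]; [by apply: heat_case; left|by apply: heat_case; right|].
  have E2 : la * c0 / 2 * T ^+ 2 <= K * (h + T ^+ 3).
    apply: le_trans (EQ (g j)).
    have -> : la * c0 / 2 * T ^+ 2 = la / 2 * (c0 * T ^+ 2) by ring.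
    apply: ler_pM; rewrite ?divr_ge0 ?mulr_ge0 ?exprn_ge0 ?(ltW la0) ?(ltW c00)//.
      by rewrite ler_pM2r.
    rewrite (bigD1 j)//= ler_wpDr//.
      by apply: sumr_ge0 => j' _; rewrite mulr_ge0// sqr_ge0.
    by rewrite ler_pM ?exprn_ge0 ?(ltW c00)// -jT real_normK ?num_real.
  have KT : K * T ^+ 3 <= la * c0 / 4 * T ^+ 2.
    rewrite exprS mulrA ler_wpM2r ?exprn_ge0//.
    by move: Tl; rewrite ler_pdivlMr ?mulr_gt0//; lra.
  have : la * c0 / 4 * T ^+ 2 <= K * h by move: E2; rewrite mulrDr; lra.
  rewrite -ler_pdivlMl ?divr_gt0// => E3.
  apply: (@le_trans _ _ (T ^+ 2)); first exact: ler_wiXn2l.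
  rewrite (le_trans E3)//.
  have -> : (la * c0 / 4)^-1 * (K * h) = 4 * K / (la * c0) * h.
    by field; rewrite !gt_eqF.
  by rewrite ler_wpM2r// lerDr ltW// divr_gt0// mulr_gt0.
split=> [|i].
  rewrite (le_trans TK1)// ler_wpM2r// lerDr mulr_ge0 ?(ltW K0)//.
  by rewrite addr_ge0// ltW.
(* At order zero the moment is the mass of the group; its remainder [T ^+ r.+1] is at most [T ^+ r],
   already bounded by the distance. *)
have := EP i 0%N (leq0n _); rewrite mul1r; under eq_bigr do rewrite heat_coef0 mulr1.
move=> /le_trans; apply.
rewrite mulrDl ler_wpDr ?mulr_ge0 ?(ltW K10)// -mulrA ler_wpM2l ?(ltW K0)//.
rewrite mulrDl mul1r lerD2l (le_trans _ TK1)// exprS.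
by rewrite ler_piMl// exprn_ge0.
Qed.

(** The factor two of the skew density cancels the one half in the total variation. *)
Lemma tv_dist_half (R : realType) (G G0 : mixing R)
    (g : 'I_(natoms G) -> 'I_(natoms G0)) :
  (forall j, 0 < sqscale (atom G j)) -> (forall i, 0 < sqscale (atom G0 i)) ->
  let th i := location (atom G0 i) in
  let v i := sqscale (atom G0 i) in
  let l i := slant (atom G0 i) / Num.sqrt (v i) in
  tv_dist (mix_pdf G) (mix_pdf G0) =
  half_L1_dist th v l g (weight G)
    (fun j => location (atom G j) - th (g j))
    (fun j => (sqscale (atom G j) - v (g j)) / 2)
    (fun j => slant (atom G j) / Num.sqrt (sqscale (atom G j)) - l (g j))
    (weight G0).
Proof.
move=> v0 v00 th v l; rewrite /tv_dist /half_L1_dist.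
have E (H : mixing R) x : (forall j, 0 < sqscale (atom H j)) ->
    mix_pdf H x = 2 * \sum_j weight H j * skew_half (location (atom H j))
      (sqscale (atom H j)) (slant (atom H j) / Num.sqrt (sqscale (atom H j))) x.
  move=> H0; rewrite /mix_pdf mulr_sumr; apply: eq_bigr => j _.
  by rewrite /scale skew_pdfE// /skew_half; ring.
pose D x := \sum_j weight G j * skew_half (location (atom G j))
      (sqscale (atom G j)) (slant (atom G j) / Num.sqrt (sqscale (atom G j))) x -
   \sum_i weight G0 i * skew_half (th i) (v i) (l i) x.
have iD : lebesgue_measure.-integrable setT (EFin \o D).
  have -> : EFin \o D = ((EFin \o (fun x => \sum_j weight G j * skew_half (location (atom G j))
      (sqscale (atom G j)) (slant (atom G j) / Num.sqrt (sqscale (atom G j))) x)%R) \-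
    (EFin \o (fun x => \sum_i weight G0 i * skew_half (th i) (v i) (l i) x)%R))%E.
    by apply/funext => x /=; rewrite EFinB.
  apply: integrableB => //.
    apply: (@integrable_lincomb _ _ _ (weight G) (fun j => skew_half
      (location (atom G j)) (sqscale (atom G j))
      (slant (atom G j) / Num.sqrt (sqscale (atom G j))))) => j.
    exact: (integrable_skew_half _ _ (v0 j)).
  apply: (@integrable_lincomb _ _ _ (weight G0) (fun i => skew_half (th i) (v i) (l i))) => i.
  exact: (integrable_skew_half _ _ (v00 i)).
have -> : \int[lebesgue_measure]_x `|mix_pdf G x - mix_pdf G0 x| =
    \int[lebesgue_measure]_x (2 * `|D x|).
  apply: eq_Rintegral => x _; rewrite !E// -mulrBr normrM ger0_norm//.
rewrite RintegralZl//; last exact: (integrable_norm iD).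
rewrite mulKf; last by rewrite pnatr_eq0.
have e1 j : th (g j) + (location (atom G j) - th (g j)) = location (atom G j).
  by rewrite addrC subrK.
have e2 j : v (g j) + 2 * ((sqscale (atom G j) - v (g j)) / 2) = sqscale (atom G j).
  by field.
have e3 j (y : R) : l (g j) + (y - l (g j)) = y by rewrite addrC subrK.
apply: eq_Rintegral => x _.
by under [X in _ = `|X - _|]eq_bigr do rewrite e1 e2 e3.
Qed.

Theorem theorem4p7 (R : realType) (Theta : set (R * R)) (Omega : set R)
    (Omega_gt0 : forall v, Omega v -> 0 < v)
    (k0 : nat) (G0 : mixing R) (G0E : mixE k0 Theta Omega G0)
    (scale_inj : injective (fun i => scale (atom G0 i)))
    (conformant : forall i j : 'I_(natoms G0), j != i ->
       scale (atom G0 i) ^+ 2 / (1 + slant (atom G0 i) ^+ 2)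
         != scale (atom G0 j) ^+ 2)
    (slant_neq0 : forall i, slant (atom G0 i) != 0)
    (no_cousins : forall i, cousins G0 i = finset.set0)
    (k : nat) (k_gt : (k0 + 1 <= k)%N)
    (rbar : nat) (rbarP : is_rbar R (k - k0 + 1) rbar)
    (c0 : R) (c0_gt0 : 0 < c0) :
  exists eps0 C0 : R, [/\ 0 < eps0, 0 < C0 &
    forall G : mixing R, mixOc k c0 Theta Omega G ->
      wasserstein (mbar rbar) G G0 <= eps0 ->
      C0 * wasserstein (mbar rbar) G G0 ^+ mbar rbar
        <= tv_dist (mix_pdf G) (mix_pdf G0)].
Proof.
set r := mbar rbar; have rr : (rbar <= r)%N by rewrite /r /mbar; case: ifP.
have N2 : (2 <= k - k0 + 1)%N by lia.
have arith a s : (a + k0 <= s.+1)%N -> (s <= k)%N -> (a <= k - k0 + 1)%N by lia.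
have rbar4 : (4 <= rbar)%N.
  have [_ nosol _] := rbarP; rewrite ltnNge; apply/negP => r3; apply: nosol.
  exact: has_nontrivial_solution_le3.
have r2 : (2 <= r)%N by lia.
have r0 : (0 < r)%N by lia.
have [natomsE in0] := G0E.
pose th i := location (atom G0 i); pose v i := sqscale (atom G0 i).
pose m i := slant (atom G0 i); pose l i := m i / Num.sqrt (v i).
have v0 i : 0 < v i by apply: Omega_gt0; have [] := in0 i.
have sv0 i : 0 < Num.sqrt (v i) by rewrite sqrtr_gt0.
have scale2 i : scale (atom G0 i) ^+ 2 = v i by rewrite /scale sqr_sqrtr//; exact: ltW (v0 i).
(* Translates the conditions on [sigma ^ 2 / (1 + m ^ 2)] into conditions on inverse variances. *)
have keyE i : (v i)^-1 + l i ^+ 2 = (v i / (1 + m i ^+ 2))^-1.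
  have h : 1 + m i ^+ 2 != 0 by rewrite gt_eqF// ltr_pwDl// sqr_ge0.
  rewrite /l exprMn exprVn sqr_sqrtr ?(ltW (v0 i))//; field.
  by rewrite h gt_eqF.
have gen : generic_params th v l.
  split=> //.
  - by move=> i j vij; apply: scale_inj; rewrite /scale -/(v i) vij.
  - by move=> i; rewrite mulf_neq0 ?slant_neq0// invr_eq0 gt_eqF.
  - move=> i j; have [<-|ji] := eqVneq i j.
      rewrite addrC -subr_eq0 addrK sqrf_eq0 mulf_neq0 ?slant_neq0//.
      by rewrite invr_eq0 gt_eqF.
    rewrite keyE (inj_eq invr_inj); have := conformant i j.
    by rewrite eq_sym !scale2 => /(_ ji).
  - move=> i j; rewrite !keyE => /invr_inj ve te; apply/eqP/negPn/negP => ij.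
    have := no_cousins j => /setP /(_ i); rewrite !inE ij/=.
    by rewrite /cousin_key -/(v i) -/(m i) -/(v j) -/(m j) ve -/(th i) te eqxx.
pose c1 := Num.min c0 1.
have c10 : 0 < c1 by rewrite lt_min c0_gt0 ltr01.
have c11 : c1 <= 1 by rewrite ge_min lexx orbT.
have [K [d [K0 d0 main]]] := moment_lower_bound gen N2 rbarP rr r2 c10 c11.
have [Cp [d' [Cp0 d'0 pd]]] : exists C d : R, [/\ 0 < C, 0 < d &
    forall i (e : skew_param R) T, 0 < sqscale e -> 0 <= T -> T <= d ->
    `|location e - th i| <= T -> `|(sqscale e - v i) / 2| <= T ^+ 2 ->
    `|slant e / Num.sqrt (sqscale e) - l i| <= T ->
    param_dist e (atom G0 i) <= C * T].
  apply: uniform_constants => [i|i C C' D D' CC DD H e T e0 T0 TD h1 h2 h3].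
    have [C C_gt0 H] := param_dist_le_local (v0 i).
    exists C, (Num.min 1 (v i / 4)); split=> //.
      by rewrite lt_min ltr01 divr_gt0.
    by move=> e T e0 T0; rewrite le_min => /andP[T1 Tv]; exact: H.
  by rewrite (le_trans (H e T e0 T0 (le_trans TD DD) h1 h2 h3))// ler_wpM2r.
have [D [D0 Dd Dd']] : exists D : R, [/\ 0 < D, D <= d & D <= d'].
  exists (Num.min d d'); split; rewrite ?lt_min ?d0//.
    by rewrite ge_min lexx.
  by rewrite ge_min lexx orbT.
have D20 : 0 < D ^+ 2 by rewrite exprn_gt0.
(* Besides keeping the increments below [D], [rho] is less than half of any gap between variances,
   so an atom of [G] is near only one atom of [G0]. *)
have [_ [rho [_ rho0 near]]] : exists C rho : R, [/\ 0 < C, 0 < rho &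
    forall i (e : skew_param R), param_dist e (atom G0 i) <= rho ->
    [/\ `|location e - th i| <= D, `|(sqscale e - v i) / 2| <= D ^+ 2,
        `|slant e / Num.sqrt (sqscale e) - l i| <= D & rho <= 1] /\
        forall i', i' != i -> 2 * rho < `|v i - v i'|].
  have sep i : exists2 s : R, 0 < s & forall i', i' != i -> 2 * s < `|v i - v i'|.
    pose s := \big[Num.min/1]_(i' | i' != i) `|v i - v i'|.
    have s0 : 0 < s.
      rewrite /s; elim/big_ind: _ => // [x y x0 y0|i' ii]; first by rewrite lt_min x0.
      rewrite normr_gt0 subr_eq0; apply: contra ii => /eqP vv.
      by have [_ vI _ _ _] := gen; rewrite (vI _ _ vv).
    exists (s / 4); first by rewrite divr_gt0.
    move=> i' ii; have : s <= `|v i - v i'| by rewrite /s (bigD1 i')//= ge_min lexx.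
    lra.
  apply: (@uniform_constants R _ (fun i _ rho => forall e : skew_param R,
    param_dist e (atom G0 i) <= rho ->
    [/\ `|location e - th i| <= D, `|(sqscale e - v i) / 2| <= D ^+ 2,
        `|slant e / Num.sqrt (sqscale e) - l i| <= D & rho <= 1] /\
        forall i', i' != i -> 2 * rho < `|v i - v i'|)).
    move=> i; have [s s0 sP] := sep i.
    have [e e0 eP] := slant_ratio_near (m i) (v0 i) D0.
    exists 1, (Num.min 1 (Num.min s (Num.min e (Num.min D (D ^+ 2))))); split=> //.
      by rewrite !lt_min ltr01 s0 e0 D0 D20.
    set rho := Num.min _ _ => x xrho.
    have : rho <= rho by []. rewrite {2}/rho !le_min => /and5P[rho1 rhos rhoe rhoD rhoD2].
    have [h1 h2 h3] := param_dist_coord xrho.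
    split.
      split=> //.
      - exact: le_trans rhoD.
      - rewrite normrM normfV normr_nat ler_pdivrMr// (le_trans h3)//.
        by rewrite (le_trans rhoD2)// ler_peMr ?exprn_ge0 ?(ltW D0)// ler1n.
      - by apply: eP; [exact: le_trans rhoe|exact: le_trans rhoe].
    move=> i' ii; apply: le_lt_trans (sP i' ii); rewrite ler_pM2l//.
  move=> i K1 K2 e e' _ ee H x xe; have [[h1 h2 h3 h4] h5] := H x (le_trans xe ee).
  split; first by split=> //; exact: le_trans ee h4.
  by move=> i' /h5; apply: le_lt_trans; rewrite ler_pM2l.

have [eps eps0 close] := wasserstein_close G0 r0 c0_gt0 rho0.
(* Any atom of [G] is within three, one for each coordinate, of its neighbour; the double sum covers
   every distance between atoms of [G0]. *)
pose Dm := 3 + \sum_i \sum_i' param_dist1 (atom G0 i) (atom G0 i').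
have pd1_ge0 (e e' : skew_param R) : 0 <= param_dist1 e e' by rewrite !addr_ge0.
have Dm0 : 0 <= Dm by rewrite addr_ge0//; do 2 (apply: sumr_ge0 => ? _).
pose Kf := Cp ^+ r * K + Dm ^+ r * ((natoms G0)%:R * K).
have Kf0 : 0 < Kf.
  rewrite ltr_pwDl// ?mulr_gt0 ?exprn_gt0// mulr_ge0 ?exprn_ge0//.
  by rewrite mulr_ge0// ltW.
exists eps, Kf^-1; split; rewrite ?invr_gt0// => G [[sizeG inG] wc0] Wle.
rewrite mulrC ler_pdivrMr// mulrC.
have [cl1 cl2] := close G wc0 Wle.
have [g gP] := choice cl1.
have vj0 j : 0 < sqscale (atom G j) by apply: Omega_gt0; have [] := inG j.
(* Some atom of [G] is close to atom [i]; by the separation of the variances [g] can only have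
   assigned it to [i]. *)
have surj i : exists j, g j = i.
  have [j ji] := cl2 i; exists j; apply/eqP/negPn/negP => gi.
  have [_ /(_ i)] := near _ _ (gP j); rewrite eq_sym gi => /(_ isT).
  have [_ _] := param_dist_coord ji; have [_ _] := param_dist_coord (gP j).
  rewrite -/(v i) -/(v (g j)) => h1 h2; rewrite ltNge => /negP; apply.
  rewrite (le_trans (ler_distD (sqscale (atom G j)) _ _))//.
  by rewrite mulr_natl mulr2n lerD// distrC.
have cardN i : (#|[set j | g j == i]%SET| <= k - k0 + 1)%N.
  have := card_fiber_le surj i; rewrite !card_ord => cG.
  by apply: arith sizeG; rewrite -natomsE.
have wc1 j : c1 <= weight G j by rewrite (le_trans _ (wc0 j))// ge_min lexx.
pose dt j := location (atom G j) - th (g j).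
pose b j := (sqscale (atom G j) - v (g j)) / 2.
pose dl j := slant (atom G j) / Num.sqrt (sqscale (atom G j)) - l (g j).
(* The square root gives [b] its weight two. The maximum over the atoms is reached, which yields the
   alternative [attained]. *)
pose tt j := Num.max `|dt j| (Num.max (Num.sqrt `|b j|) `|dl j|).
have [j1 _|noG] := pickP (fun i : 'I_(natoms G) => true); last first.
  have : \sum_i weight G i = 0 by apply: big1 => i; have := noG i.
  by move=> /eqP; rewrite weight_sum1 oner_eq0.
case: (@Order.TotalTheory.arg_maxP _ _ _ j1 xpredT tt isT) => j0 _ ttmax.
pose T := tt j0.
have ttT j : [/\ `|dt j| <= T, `|b j| <= T ^+ 2 & `|dl j| <= T].
  have : tt j <= T by exact: ttmax.
  rewrite /tt !ge_max => /and3P[h1 h2 h3]; split=> //.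
  rewrite -[leLHS]sqr_sqrtr// lerXn2r ?nnegrE ?sqrtr_ge0//.
  exact: le_trans h1.
have T0 : 0 <= T by have [h _ _] := ttT j0; exact: le_trans h.
have TD : T <= D.
  have [[h1 h2 h3 _] _] := near _ _ (gP j0).
  have hb : Num.sqrt `|b j0| <= D.
    have -> : D = Num.sqrt (D ^+ 2) by rewrite sqrtr_sqr ger0_norm// ltW.
    by rewrite ler_sqrt// ltW.
  by rewrite /T /tt !ge_max h1 hb h3.
have sp : small_params (weight G) dt b dl d T.
  split=> //; last by rewrite T0 (le_trans TD).
  - by move=> j; exact: ltW (weight_gt0 j).
  - exact: weight_sum1.
have attained : T = 0 \/ exists j, [\/ `|dt j| = T, `|b j| = T ^+ 2 | `|dl j| = T].
  right; exists j0; rewrite /T /tt.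
  have [h|h] := leP `|dt j0| (Num.max (Num.sqrt `|b j0|) `|dl j0|); last by constructor 1.
  have [h'|h'] := leP (Num.sqrt `|b j0|) `|dl j0|; first by constructor 3.
  by constructor 2; rewrite sqr_sqrtr.
have [TK wK] := main _ g (weight G) dt b dl (weight G0) T sp wc1 cardN attained.
set h := half_L1_dist _ _ _ _ _ _ _ _ _ in TK wK.
have tvE : tv_dist (mix_pdf G) (mix_pdf G0) = h by exact: tv_dist_half.
rewrite tvE.
have h0 : 0 <= h by exact: Rintegral_ge0.
have dist_Dm j i : param_dist (atom G j) (atom G0 i) <= Dm.
  rewrite (le_trans (param_dist_le1 _ _))//.
  rewrite (le_trans (param_dist1_triangle _ (atom G0 (g j)) _))// lerD//.
    have [[_ _ _ rho1] _] := near _ _ (gP j).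
    have [h1 h2 h3] := param_dist_coord (gP j); rewrite /param_dist1.
    by move: h1 h2 h3 rho1; lra.
  rewrite (bigD1 (g j))//= (bigD1 i)//= -addrA lerDl addr_ge0//.
    by apply: sumr_ge0.
  by do 2 (apply: sumr_ge0 => ? _).
(* Moving within the groups costs at most [(Cp * T) ^+ r]; the mass defects of the groups travel at
   most [Dm]. The two parts of [Kf] match these costs. *)
apply: le_trans (wasserstein_exp_le_assignment g r0 dist_Dm) _.
rewrite /Kf mulrDl; apply: lerD.
  rewrite -[leRHS]mul1r -(weight_sum1 G) mulr_suml; apply: ler_sum => j _.
  rewrite ler_wpM2l ?(ltW (weight_gt0 j))//.
  have [h1 h2 h3] := ttT j.
  have pj : param_dist (atom G j) (atom G0 (g j)) <= Cp * T.
    by apply: pd => //; exact: le_trans Dd'.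
  rewrite (@le_trans _ _ ((Cp * T) ^+ r))//.
    by rewrite lerXn2r ?nnegrE ?param_dist_ge0// (le_trans _ pj) ?param_dist_ge0.
  by rewrite exprMn -mulrA ler_wpM2l ?exprn_ge0 ?(ltW Cp0).
rewrite -mulrA ler_wpM2l ?exprn_ge0//.
have -> : (natoms G0)%:R * K * h = \sum_(i < natoms G0) K * h.
  by rewrite sumr_const card_ord -[RHS]mulr_natl mulrA.
by apply: ler_sum => i _; exact: wK.
Qed.
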